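(* Let $\mathcal{C}$ and $\mathcal{D}$ be permutation classes. The juxtaposition $[\mathcal{C}\ \mathcal{D}]$ is labelled well-quasi-ordered if and only if both $\mathcal{C}$ and $\mathcal{D}$ are labelled well-quasi-ordered and at least one of $\mathcal{C}$ or $\mathcal{D}$ contains only finitely many zigzag permutations.
   Context: A permutation of length $n$ is an ordering $\pi=\pi(1)\cdots\pi(n)$ of $[n]=\{1,\dots,n\}$. A permutation $\sigma$ of length $k$ is contained in $\pi$ if there are indices $i_1<\cdots<i_k$ such that $\pi(i_1)\cdots\pi(i_k)$ is order isomorphic to $\sigma$ (has the same relative order). A permutation class is a set of permutations closed downwards under containment. The juxtaposition $[\mathcal{C}\ \mathcal{D}]$ of classes $\mathcal{C},\mathcal{D}$ is the class of all permutations that can be written as a concatenation $\sigma\tau$ where $\sigma$ is order isomorphic to a permutation in $\mathcal{C}$ and $\tau$ is order isomorphic to a permutation in $\mathcal{D}$. A zigzag permutation is a permutation $\pi$ of length $n$ such that there is no $i\in[n-2]$ for which $\pi(i)\pi(i+1)\pi(i+2)$ is monotone increasing or monotone decreasing. A quasi-order is well-quasi-ordered (wqo) if it has no infinite strictly descending chain and no infinite antichain. For a quasi-order $(L,\le_L)$, an $L$-labelled permutation is a pair $(\pi,\ell_\pi)$ with $\ell_\pi$ a map from the indices of $\pi$ to $L$; for a class $\mathcal{C}$, $\mathcal{C}\wr L$ is the set of all $L$-labelled permutations with underlying permutation in $\mathcal{C}$, ordered by: $(\sigma,\ell_\sigma)\le(\pi,\ell_\pi)$ (with $\sigma$ of length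 $m$, $\pi$ of length $n$) if there exist $1\le i_1<\cdots<i_m\le n$ with $\pi(i_1)\cdots\pi(i_m)$ order isomorphic to $\sigma$ and $\ell_\sigma(j)\le_L\ell_\pi(i_j)$ for all $j\in[m]$. A class $\mathcal{C}$ is labelled well-quasi-ordered (lwqo) if $\mathcal{C}\wr L$ is wqo for every wqo $(L,\le_L)$.
   Formalization: Both permutation classes are assumed nonempty; otherwise the claim fails, e.g. for C empty and D the class of all permutations, where [C D] is empty and so labelled well-quasi-ordered, but D is not. *)

(* Defs.v *)
From mathcomp Require Import all_boot fingroup perm.
From mathcomp Require Import boolp classical_sets functions cardinality.
From Corelib Require RelationClasses.

Set Implicit Arguments.
Unset Strict Implicit.
Unset Printing Implicit Defensive.

Local Open Scope classical_set_scope.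

(* Indices and values are taken in {0, ..., n-1} rather than {1, ..., n}.
   Length 0 is allowed: the empty permutation is contained in every
   permutation, hence belongs to every nonempty class. *)
Record permutation := Permutation { len : nat; perm_of :> 'S_len }.

(* The entries of p at positions e 0 < ... < e (k - 1) form a sequence that is
   order isomorphic to s. *)
Definition occurrence (k n : nat) (s : 'S_k) (p : 'S_n) (e : 'I_k -> 'I_n) :
    Prop :=
  (forall i j : 'I_k, i < j -> e i < e j) /\
  (forall i j : 'I_k, (s i < s j) = (p (e i) < p (e j))).

Definition contained (s p : permutation) : Prop :=
  exists e : 'I_(len s) -> 'I_(len p), occurrence s p e.

Definition permutation_class (C : set permutation) : Prop :=
  forall s p : permutation, contained s p -> C p -> C s.

(* [lshift m] and [rshift k] enumerate the first k and the last m positions of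
   a permutation of length k + m. *)
Definition juxtaposition (C D : set permutation) : set permutation :=
  fun p => exists (k m : nat) (q : 'S_(k + m)) (s : 'S_k) (t : 'S_m),
    [/\ p = Permutation q, C (Permutation s), D (Permutation t),
        occurrence s q (@lshift k m) & occurrence t q (@rshift k m)].

Definition zigzag (p : permutation) : Prop :=
  ~ exists i j k : 'I_(len p),
      [/\ j = i.+1 :> nat, k = i.+2 :> nat &
          (p i < p j < p k) || (p k < p j < p i)].

(* The elements of A form a well-quasi-order under the quasi-order le. *)
Definition wqo (T : Type) (A : set T) (le : T -> T -> Prop) : Prop :=
  ~ (exists f : nat -> T,
       forall i, [/\ A (f i), le (f i.+1) (f i) & ~ le (f i) (f i.+1)]) /\
  ~ (exists B : set T,
       [/\ B `<=` A, infinite_set B &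
           forall x y, B x -> B y -> x <> y -> ~ le x y]).

Record labelled (L : Type) := Labelled {
  underlying : permutation;
  label : 'I_(len underlying) -> L }.
Arguments label {L} l _ : rename.

Definition labelled_class (C : set permutation) (L : Type) :
    set (labelled L) :=
  fun x => C (underlying x).

Definition labelled_le (L : Type) (le : L -> L -> Prop) (x y : labelled L) :
    Prop :=
  exists e : 'I_(len (underlying x)) -> 'I_(len (underlying y)),
    occurrence (underlying x) (underlying y) e /\
    (forall j, le (label x j) (label y (e j))).

Definition lwqo (C : set permutation) : Prop :=
  forall (L : Type) (le : L -> L -> Prop),
    RelationClasses.PreOrder le -> wqo setT le ->
    wqo (@labelled_class C L) (labelled_le le).

(* Main.v *)
From Stdlib Require Import ZArith.
Require Import Defs.
From mathcomp Require Import all_boot fingroup perm.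
From mathcomp Require Import boolp classical_sets functions cardinality.
From mathcomp Require Import zify.
Local Open Scope classical_set_scope.

(** Sufficiency. If the zigzags of D are bounded, the entries of D fall into
    boundedly many monotone runs. A permutation of [C D] is then coded by its
    C-part, each entry of which carries as a label the word formed by the
    labels and run numbers of the D-entries lying just above it in value.
    Labelled embeddings of the codes, words being compared as in Higman's
    lemma, yield embeddings of the permutations.

    Necessity. If both classes have unbounded zigzags, Ramsey's theorem finds in
    each of them arbitrarily long sequences of pairs of neighbouring entries,
    either forming a sum of 21's (or a skew sum of 12's) or consisting of two
    monotone sequences, one above the other. In every combination the values of
    the two sides can be interleaved so that comparisons between consecutive
    chains of entries, taken around a cycle of chains, make every embedding
    respect consecutive indices. Marking the ends of the chains gives a bad
    sequence. *)

Set Implicit Arguments.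
Unset Strict Implicit.
Unset Printing Implicit Defensive.
Local Open Scope nat_scope.

(** * Well-quasi-orders and Higman's lemma *)

(** For quasi-orders this is equivalent to [wqo], and it passes more easily to products and
    words. *)
Definition good (T : Type) (A : set T) (le : T -> T -> Prop) : Prop :=
  forall f : nat -> T, (forall i, A (f i)) ->
  exists i j, (i < j)%N /\ le (f i) (f j).

Lemma infinite_set_injP (T : Type) (B : set T) :
  infinite_set B <-> exists2 f : nat -> T, injective f & forall i, B (f i).
Proof.
rewrite infiniteP; split=> [/card_leP[f]|[f finj fB]].
  exists (fun i => val (f (SigSub (mem_set (I : [set: nat] i))))) => [i j|i].
    by move=> /val_inj/(inj (in_setT _) (in_setT _)) [].
  exact: set_mem (valP _).
have : (range f #= [set: nat])%card.
  by apply: inj_card_eq => x y _ _ /finj.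
by rewrite card_eq_le => /andP[_ /card_le_trans]; apply; apply: subset_card_le => _ [i _ <-].
Qed.

Lemma homo_ltn_succ (g : nat -> nat) :
  (forall i, g i < g i.+1) -> forall i j, i < j -> g i < g j.
Proof. by move=> h; apply: (homo_ltn ltn_trans). Qed.

Lemma increasing_in (P : nat -> Prop) :
  (forall N, exists i, N <= i /\ P i) ->
  exists g : nat -> nat, (forall i, g i < g i.+1) /\ forall i, P (g i).
Proof.
move=> h; have [s hs] := choice h.
exists (fun n => iter n (fun m => s m.+1) (s 0)); split=> i.
  by rewrite iterS; have [] := hs (iter i (fun m => s m.+1) (s 0)).+1.
by case: i => [|i] /=; [have [] := hs 0|have [] := hs (iter i (fun m => s m.+1) (s 0)).+1].
Qed.

(* An index is terminal if it is Q-related to no later one: either the terminal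
   indices are unbounded, or from some point on a Q-successor always exists. *)
Lemma chain_or_antichain (Q : nat -> nat -> Prop) :
  exists g : nat -> nat, (forall i, g i < g i.+1) /\
   ((forall i, Q (g i) (g i.+1)) \/ (forall i j, i < j -> ~ Q (g i) (g j))).
Proof.
pose term i := forall j, i < j -> ~ Q i j.
have [h|] := pselect (forall N, exists i, N <= i /\ term i).
  have [g [gi gt]] := increasing_in h.
  exists g; split=> //; right=> i j ij; apply: gt.
  exact: homo_ltn_succ.
move/existsNP=> [N hN].
have step i : exists j, N <= i -> i < j /\ Q i j.
  have [Ni|Ni] := boolP (N <= i); last by exists 0.
  apply: contrapT => hj; apply: hN; exists i; split=> // j ij Qij.
  by apply: hj; exists j.
have [s hs] := choice step.
pose g := fix g n := if n is m.+1 then s (g m) else N.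
have gN n : N <= g n.
  by elim: n => //= n IH; have [/ltnW/(leq_trans IH)] := hs _ IH.
by exists g; split=> [i|]; [|left=> i]; have [] := hs _ (gN i).
Qed.

(** In a sequence without a related pair, the dichotomy for the reversed relation yields a
    descending chain, strict because the sequence is bad, or an infinite antichain. *)
Lemma wqo_good (T : Type) (A : set T) (le : T -> T -> Prop) :
  (forall x, le x x) -> wqo A le -> good A le.
Proof.
move=> lexx [nochain noanti] f fA; apply: contrapT => nf.
have bad i j : i < j -> ~ le (f i) (f j) by move=> ij l; apply: nf; exists i, j.
have [g [gi [ch|an]]] := chain_or_antichain (fun i j => le (f j) (f i)).
  apply: nochain; exists (f \o g) => i; split=> //=.
  exact: bad.
have inc x y : x <> y -> ~ le (f (g x)) (f (g y)).
  case: (ltngtP x y) => // xy _.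
    by apply: bad; apply: homo_ltn_succ.
  exact: an.
apply: noanti; exists (range (f \o g)); split.
- by move=> _ [i _ <-]; apply: fA.
- apply/infinite_set_injP; exists (f \o g) => [x y /= E|i]; last by exists i.
  by apply: contrapT => /inc; rewrite E; apply.
- by move=> _ _ [i _ <-] [j _ <-] ne; apply: inc => E; apply: ne; rewrite E.
Qed.

Lemma good_wqo (T : Type) (A : set T) (le : T -> T -> Prop) :
  (forall x, le x x) -> (forall x y z, le x y -> le y z -> le x z) ->
  good A le -> wqo A le.
Proof.
move=> lexx letr gd; split=> [[f hf]|[B [BA Binf Banti]]].
  have fA i : A (f i) by have [] := hf i.
  have [i [j [ij l]]] := gd f fA.
  (* Descent puts [f j] below [f i.+1], so [f i] below [f j] contradicts strictness at [i]. *)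
  have [_ _] := hf i; apply; apply: (letr) l _.
  elim: j ij => // j IH; rewrite ltnS leq_eqVlt => /predU1P[<-|/IH h].
    exact: lexx.
  by have [_ ? _] := hf j; apply: (letr) h.
have /infinite_set_injP[f finj fB] := Binf.
have [i [j [ij l]]] := gd f (fun i => BA _ (fB i)).
apply: (Banti (f i) (f j)) l; [exact: fB|exact: fB|].
by move=> /finj E; rewrite E ltnn in ij.
Qed.

Lemma good_subsequence (T : Type) (A : set T) (le : T -> T -> Prop) :
  (forall x y z, le x y -> le y z -> le x z) -> good A le ->
  forall f : nat -> T, (forall i, A (f i)) ->
  exists g : nat -> nat, (forall i j, i < j -> g i < g j) /\
    forall i j, i < j -> le (f (g i)) (f (g j)).
Proof.
move=> letr gd f fA.
have [g [gi [ch|an]]] := chain_or_antichain (fun i j => le (f i) (f j)).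
  exists g; split; first exact: homo_ltn_succ.
  by apply: (@homo_ltn _ (f \o g) le (fun y x z => @letr x y z)).
have [i [j [ij l]]] := gd (f \o g) (fun i => fA _).
by case: (an _ _ ij).
Qed.

Lemma good_finType (T : finType) : good (@setT T) eq.
Proof.
move=> f _; apply: contrapT => nf.
have inj : injective (fun i : 'I_#|T|.+1 => f i).
  move=> i j E; apply/val_inj => /=.
  by case: (ltngtP i j) => // ij; case: nf; [exists i, j|exists j, i].
by have := leq_card _ inj; rewrite card_ord ltnn.
Qed.

Inductive subword (T : Type) (le : T -> T -> Prop) : seq T -> seq T -> Prop :=
| subword_nil : subword le [::] [::]
| subword_skip y u v : subword le u v -> subword le u (y :: v)
| subword_cons x y u v : le x y -> subword le u v -> subword le (x :: u) (y :: v).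

Section Subword.
Variables (T : Type) (le : T -> T -> Prop).

Lemma subword0 v : subword le [::] v.
Proof. by elim: v => [|y v IH]; constructor. Qed.

Lemma subword_refl : (forall x, le x x) -> forall u, subword le u u.
Proof. by move=> lexx; elim=> [|x u IH]; constructor. Qed.

Lemma subword_trans : (forall x y z, le x y -> le y z -> le x z) ->
  forall u v w, subword le u v -> subword le v w -> subword le u w.
Proof.
move=> letr u v w uv vw; elim: vw u uv => {v w} [|y v w vw IH|x y v w xy vw IH] u uv //.
  by constructor; apply: IH.
inversion uv as [|? ? ? uv'|x' ? u' ? lx uv']; subst.
  by constructor; apply: IH.
by constructor; [apply: letr lx xy|apply: IH].
Qed.

Section Higman.
Hypothesis letr : forall x y z, le x y -> le y z -> le x z.
Hypothesis legood : good setT le.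

Definition bad_seq (f : nat -> seq T) : Prop :=
  forall i j, i < j -> ~ subword le (f i) (f j).

Definition bad_prefix (s : seq (seq T)) : Prop :=
  exists2 f, bad_seq f & forall i, i < size s -> f i = nth [::] s i.

(** Lengths being natural numbers, the next word can be chosen shortest; iterating this gives the
    minimal bad sequence of [higman]. *)
Lemma bad_prefix_rcons s : bad_prefix s ->
  exists w, bad_prefix (rcons s w) /\
    forall v, bad_prefix (rcons s v) -> size w <= size v.
Proof.
move=> [f fbad fs].
have bf : bad_prefix (rcons s (f (size s))).
  exists f => // i; rewrite size_rcons ltnS nth_rcons leq_eqVlt.
  by case: ltngtP => [/fs|//|->] //=.
have [n] : exists n, `[< exists2 w, size w = n & bad_prefix (rcons s w) >].
  by exists (size (f (size s))); apply/asboolP; eexists.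
move=> hn; have ex : exists n, `[< exists2 w, size w = n & bad_prefix (rcons s w) >].
  by exists n.
case: (ex_minnP ex) => m /asboolP[w wm wb] mmin.
exists w; split=> // v vb; rewrite wm; apply: mmin; apply/asboolP; by exists v.
Qed.

(* Nash-Williams: in a bad sequence whose words are chosen successively of
   minimal length, cutting off the first letters of a subsequence along which
   they increase would give a smaller bad sequence. *)
Lemma higman : good setT (subword le).
Proof.
move=> f0 _; apply: contrapT => nf0.
have bad0 : bad_prefix [::].
  by exists f0 => // i j ij l; apply: nf0; exists i, j.
have step s : exists w, bad_prefix s -> bad_prefix (rcons s w) /\
    forall v, bad_prefix (rcons s v) -> size w <= size v.
  have [/bad_prefix_rcons[w hw]|nb] := pselect (bad_prefix s); last by exists [::].
  by exists w.
have [next hnext] := choice step.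
pose pref := fix pref n := if n is m.+1 then rcons (pref m) (next (pref m)) else [::].
pose m n := next (pref n).
have prefb n : bad_prefix (pref n).
  by elim: n => //= n IH; have [] := hnext _ IH.
have size_pref n : size (pref n) = n by elim: n => //= n IH; rewrite size_rcons IH.
have nth_pref n i : i < n -> nth [::] (pref n) i = m i.
  elim: n => //= n IH; rewrite ltnS leq_eqVlt nth_rcons size_pref.
  by case: ltngtP => // [/IH|->].
have mbad : bad_seq m.
  move=> i j ij; have [f fbad ff] := prefb j.+1.
  rewrite -(nth_pref j.+1 i) ?(ltn_trans ij) // -(nth_pref j.+1 j) //.
  by rewrite -!ff ?size_pref ?(ltn_trans ij) //; apply: fbad.
have mmin n v : bad_prefix (rcons (pref n) v) -> size (m n) <= size v.
  by have [_] := hnext _ (prefb n); apply.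
have mcons n : exists at_, m n = at_.1 :: at_.2.
  have := mbad n n.+1 (ltnSn n); case: (m n) => [|a t] h; last by exists (a, t).
  by case: h; apply: subword0.
have [at_ hat] := choice mcons.
have [g [gi gle]] :=
  good_subsequence letr legood (f := fun n => (at_ n).1) (fun=> I).
(* [h] follows [m] up to [g 0] and then runs through the tails of the words [m (g i)]. An embedding
   into a tail is also one into the whole word. *)
pose h i := if i < g 0 then m i else (at_ (g (i - g 0))).2.
have g0 i : g 0 <= g i.
  by case: i => // i; apply/ltnW/gi.
have hbad : bad_seq h.
  move=> i j ij; rewrite /h; case: ifPn => iN; case: ifPn => jN.
  - exact: mbad.
  - move=> l; apply: (mbad i (g (j - g 0))); first exact: leq_trans (g0 _).
    by rewrite [m (g _)]hat; apply: subword_skip.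
  - by move: iN jN ij; lia.
  - move=> l; apply: (mbad (g (i - g 0)) (g (j - g 0))); first by apply: gi; lia.
    by rewrite !hat; apply: subword_cons => //; apply: gle; lia.
have : bad_prefix (rcons (pref (g 0)) (at_ (g 0)).2).
  exists h => // i; rewrite size_rcons size_pref ltnS nth_rcons size_pref /h.
  by case: ltngtP => // [ig _|-> _]; rewrite ?nth_pref // subnn.
by move/mmin; rewrite {1}hat /= ltnn.
Qed.

End Higman.
End Subword.

(** The witness [v'] lies in [v] itself and not in its image, so that [framing_embedding] can match
    entries and not just their codes. *)
Lemma subword_map (S1 T2 : Type) (T : eqType) (le : S1 -> S1 -> Prop)
    (f : T2 -> S1) (g : T -> S1) (x0 : T2) (y0 : T) (u : seq T2) (v : seq T) :
  subword le (map f u) (map g v) ->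
  exists v', [/\ subseq v' v, size v' = size u &
    forall i, i < size u -> le (f (nth x0 u i)) (g (nth y0 v' i))].
Proof.
elim: v u => [|y v IH] [|x u] /= h.
- by exists [::].
- by inversion h.
- by exists [::]; split=> //; apply: sub0seq.
- inversion h as [|? ? ? h'|? ? ? ? lxy h']; subst.
    have [v' [sv sz le']] := IH (x :: u) h'.
    exists v'; split=> //; exact: (subseq_trans sv (subseq_cons _ _)).
  have [v' [sv sz le']] := IH u h'.
  exists (y :: v'); split=> //=; rewrite ?eqxx ?sz //.
  by case=> [|i] // /le'.
Qed.

(** * Permutations framed by a labelled core *)

Lemma card_ord_lt (n m : nat) : m <= n -> #|[pred i : 'I_n | i < m]| = m.
Proof.
move=> mn; rewrite -sum1_card (eq_bigl (fun i : 'I_n => true && (i < m))) //.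
by rewrite (big_ord_narrow_cond mn) /= sum1_card card_ord.
Qed.

Lemma occurrence_le (k n : nat) (s : 'S_k) (p : 'S_n) (e : 'I_k -> 'I_n) :
  occurrence s p e -> forall i j, (s i <= s j) = (p (e i) <= p (e j)).
Proof. by move=> [_ eV] i j; rewrite leqNgt eV -leqNgt. Qed.

Lemma occurrence_trans (k m n : nat) (s : 'S_k) (q : 'S_m) (p : 'S_n)
    (e : 'I_k -> 'I_m) (f : 'I_m -> 'I_n) :
  occurrence s q e -> occurrence q p f -> occurrence s p (f \o e).
Proof.
move=> [eI eV] [fI fV]; split=> i j; first by move=> /eI/fI.
by rewrite eV fV.
Qed.

Lemma labelled_le_refl (L : Type) (le : L -> L -> Prop) :
  (forall x, le x x) -> forall x, labelled_le le x x.
Proof. by move=> lexx x; exists id. Qed.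

Lemma labelled_le_trans (L : Type) (le : L -> L -> Prop) :
  (forall x y z, le x y -> le y z -> le x z) ->
  forall x y z, labelled_le le x y -> labelled_le le y z -> labelled_le le x z.
Proof.
move=> letr x y z [e [eo el]] [f [fo fl]]; exists (f \o e); split.
  exact: occurrence_trans eo fo.
by move=> j; apply: letr (el j) (fl _).
Qed.

(** * Strips of values cut out by a core *)

Section Blocks.
Variables (n k : nat) (p : 'S_n) (e : 'I_k -> 'I_n).

(** The [k] core values cut the permutation into [k + 1] horizontal strips. A core entry is the
    lowest entry of its strip, and strip 0 contains none. *)
Definition level (z : 'I_n) : nat := #|[pred j : 'I_k | p (e j) <= p z]|.

Definition block (t : nat) : seq 'I_n :=
  [seq z <- [seq p^-1%g v | v <- enum 'I_n] | level z == t].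

Lemma level_le z : level z <= k.
Proof. by rewrite -[X in _ <= X]card_ord max_card. Qed.

Lemma leq_level z z' : p z <= p z' -> level z <= level z'.
Proof.
move=> zz'; apply: subset_leq_card; apply/fintype.subsetP => j; rewrite !inE => /leq_trans; exact.
Qed.

Lemma level_occurrence (s : 'S_k) : occurrence s p e ->
  forall j, level (e j) = (s j).+1.
Proof.
move=> ho j; rewrite /level -(card_ord_lt (ltn_ord (s j))).
rewrite -(fintype.card_image (@perm_inj _ s)); apply: eq_card => i.
rewrite [RHS]inE; apply/fintype.imageP/idP => [[i' + ->]|h].
  by rewrite inE -(occurrence_le ho) ltnS.
exists (s^-1%g i); last by rewrite permKV.
by rewrite inE -(occurrence_le ho) permKV -ltnS.
Qed.

Lemma mem_block z t : (z \in block t) = (level z == t).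
Proof.
rewrite mem_filter andb_idr // => _; apply/mapP; exists (p z).
  by rewrite mem_enum.
by rewrite permK.
Qed.

Lemma sorted_block t : sorted (fun x y => p x < p y) (block t).
Proof.
apply: sorted_filter; first by move=> y x z; apply: ltn_trans.
rewrite sorted_map (eq_sorted (e' := relpre val ltn)).
  by rewrite -sorted_map val_enum_ord iota_ltn_sorted.
by move=> x y /=; rewrite !permKV.
Qed.

Lemma sub_block_lt t V : subseq V (block t) -> forall x0 i j,
  i < size V -> j < size V -> (p (nth x0 V i) < p (nth x0 V j)) = (i < j).
Proof.
move=> sV x0.
have tr : transitive (fun x y : 'I_n => p x < p y) by move=> y x z; apply: ltn_trans.
have so : sorted (fun x y => p x < p y) V := subseq_sorted tr sV (sorted_block t).
have lt i j : i < size V -> j < size V -> i < j -> p (nth x0 V i) < p (nth x0 V j).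
  by move=> iV jV ij; apply: (sorted_ltn_nth tr x0 so).
move=> i j iV jV; case: (ltngtP i j) => [|ji|->]; first exact: lt.
  by apply/negbTE; rewrite -leqNgt ltnW // lt.
by rewrite ltnn.
Qed.

Definition block_word (L : Type) (code : 'I_n -> L) (t : nat) : seq L :=
  [seq code z | z <- block t].

End Blocks.

(* The positions without tag form the core, an occurrence of s. The table F
   recovers the order of positions outside the core from tags and values. *)
Definition framing (K n k : nat) (p : 'S_n) (s : 'S_k) (e : 'I_k -> 'I_n)
    (tag : 'I_n -> option 'I_K)
    (F : {ffun option 'I_K * option 'I_K * bool -> bool}) : Prop :=
  [/\ occurrence s p e,
      (forall x, tag x = None <-> exists j, x = e j) &
      forall x y, x != y -> tag x <> None \/ tag y <> None ->
        (x < y) = F (tag x, tag y, p x < p y)].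

Definition prod_le (S T : Type) (leS : S -> S -> Prop) (leT : T -> T -> Prop)
    (x y : S * T) : Prop := leS x.1 y.1 /\ leT x.2 y.2.

(** Strips go to strips along [g], and entries within a strip along the word embedding, which
    settles values. Tags are matched exactly, so [F] transfers the order of positions whenever an
    entry outside the core is involved; core entries follow [g]. *)
Lemma framing_embedding (L : Type) (le : L -> L -> Prop) (K n k n' k' : nat)
    (p : 'S_n) (s : 'S_k) (e : 'I_k -> 'I_n) tag
    (p' : 'S_n') (s' : 'S_k') (e' : 'I_k' -> 'I_n') tag' F
    (lab : 'I_n -> L) (lab' : 'I_n' -> L) (g : 'I_k -> 'I_k') :
  let word := block_word p e (fun z => (lab z, tag z)) in
  let word' := block_word p' e' (fun z => (lab' z, tag' z)) in
  @framing K n k p s e tag F -> @framing K n' k' p' s' e' tag' F ->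
  occurrence s s' g ->
  (forall j, subword (prod_le le eq) (word (s j).+1) (word' (s' (g j)).+1)) ->
  subword (prod_le le eq) (word 0) (word' 0) ->
  exists f : 'I_n -> 'I_n', occurrence p p' f /\ forall z, le (lab z) (lab' (f z)).
Proof.
move=> word word' [ho tagN hF] [ho' tagN' hF'] hg hw h0.
(* [G] matches the strips: the lowest with the lowest, and that of a core entry with that of its
   image under [g]. *)
pose G t t' := (t = 0 /\ t' = 0) \/ exists j, t = (s j).+1 /\ t' = (s' (g j)).+1.
have exG t : exists t', t <= k -> G t t'.
  have [tk|tk] := boolP (t <= k); last by exists 0.
  case: t tk => [|t] tk; first by exists 0; left.
  pose j := (s^-1)%g (Ordinal tk).
  by exists (s' (g j)).+1; right; exists j; rewrite permKV.
have [gam hgam] := choice exG.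
have GE z : G (level p e z) (gam (level p e z)) by apply: hgam; apply: level_le.
have Glt t1 t1' t2 t2' : G t1 t1' -> G t2 t2' -> (t1 < t2) = (t1' < t2').
  move=> [[-> ->]|[j [-> ->]]] [[-> ->]|[j' [-> ->]]] //.
  by rewrite !ltnS hg.2.
have Gw t t' : G t t' -> subword (prod_le le eq) (word t) (word' t').
  by move=> [[-> ->]|[j [-> ->]]].
have [n0|n0] := posnP n.
  subst n; exists (fun z : 'I_0 => match notF (ltn_ord z) with end).
  by split; [split|]; case.
(* The word of a nonempty strip cannot embed in an empty word; this supplies the default [y0]. *)
have n'0 : 0 < n'.
  case: (posnP n') => // E; pose z := Ordinal n0; have := Gw _ _ (GE z).
  rewrite /word' /block_word; case: (block p' e' _) => [|y l]; last first.
    by move: (ltn_ord y); rewrite [X in _ < X]E.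
  have : z \in block p e (level p e z) by rewrite mem_block.
  by rewrite /word /block_word; case: (block p e _) => // a b _ h; inversion h.
pose x0 := Ordinal n0; pose y0 := Ordinal n'0.
pose B t := block p e t; pose B' t := block p' e' (gam t).
have exV t : exists V, t <= k -> [/\ subseq V (B' t), size V = size (B t) &
    forall i, i < size (B t) ->
    prod_le le eq (lab (nth x0 (B t) i), tag (nth x0 (B t) i))
     (lab' (nth y0 V i), tag' (nth y0 V i))].
  have [tk|tk] := boolP (t <= k); last by exists [::].
  have [V hV] := subword_map x0 y0 (Gw _ _ (hgam t tk)).
  by exists V.
have [V hV] := choice exV.
pose lv := level p e.
pose idx z := index z (B (lv z)).
(* An entry goes to the entry of the same rank in the subsequence [V] selected in the target
   strip. *)
pose f z := nth y0 (V (lv z)) (idx z).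
have zB z : z \in B (lv z) by rewrite mem_block.
have idxB z : idx z < size (B (lv z)) by rewrite index_mem.
have idxV z : idx z < size (V (lv z)).
  by have [_ -> _] := hV _ (level_le p e z).
have fB z : level p' e' (f z) = gam (lv z).
  apply/eqP; rewrite -mem_block; have [sV _ _] := hV _ (level_le p e z).
  exact: (mem_subseq sV (mem_nth _ (idxV z))).
have fcode z : le (lab z) (lab' (f z)) /\ tag z = tag' (f z).
  have [_ _ h] := hV _ (level_le p e z).
  by have := h _ (idxB z); rewrite nth_index.
have fval z z' : (p z < p z') = (p' (f z) < p' (f z')).
  have [E|ne] := eqVneq (lv z) (lv z').
    have iz' : idx z' = index z' (B (lv z)) by rewrite /idx E.
    have iB' : idx z' < size (B (lv z)) by rewrite E.
    have iV' : idx z' < size (V (lv z)) by rewrite E.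
    have [sV _ _] := hV _ (level_le p e z).
    have -> : (p' (f z) < p' (f z')) = (idx z < idx z').
      by rewrite /f -E (sub_block_lt sV y0).
    rewrite -(sub_block_lt (subseq_refl (B (lv z))) x0 (idxB z) iB').
    by rewrite nth_index // iz' nth_index // E.
  have -> : (p z < p z') = (lv z < lv z').
    case: (ltnP (p z) (p z')) => [/ltnW|] /(leq_level e); rewrite -/(lv z) -/(lv z').
      by rewrite leq_eqVlt (negbTE ne).
    by rewrite ltnNge => ->.
  have ne' : level p' e' (f z) != level p' e' (f z').
    move: ne; rewrite !fB !neq_ltn.
    by rewrite (Glt _ _ _ _ (GE z) (GE z')) (Glt _ _ _ _ (GE z') (GE z)).
  have -> : (p' (f z) < p' (f z')) = (gam (lv z) < gam (lv z')).
    rewrite -!fB; case: (ltnP (p' (f z)) (p' (f z'))) => [/ltnW|] /(leq_level e').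
      by rewrite leq_eqVlt (negbTE ne').
    by rewrite ltnNge => ->.
  exact: Glt (GE z) (GE z').
exists f; split; last by move=> z; have [] := fcode z.
split=> // x y xy.
have fxy : f x != f y.
  apply/eqP => E; have xney : x != y by rewrite neq_ltn xy.
  have: p x != p y by rewrite (inj_eq perm_inj).
  by rewrite neq_ltn !fval E ltnn.
(* [f z] has no tag either, so it is a core entry, and a core entry is determined by its level. *)
have core z j : z = e j -> f z = e' (g j).
  move=> E; have [/esym t _] : tag z = None /\ true by split=> //; apply/tagN; exists j.
  have [_ tE] := fcode z; rewrite tE in t.
  have [j' E'] := (tagN' (f z)).1 (esym t).
  rewrite E'; congr (e' _); apply: (@perm_inj _ s'); apply/val_inj/succn_inj.
  rewrite -(level_occurrence ho') -E' fB.
  have lvz : lv z = (s j).+1 by rewrite E /lv (level_occurrence ho).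
  have := GE z; rewrite -/(lv z) lvz.
  by case=> [[]|[i [[/val_inj/perm_inj <-] ->]]].
have [|nc] := pselect (tag x <> None \/ tag y <> None).
  move=> c; have := hF x y; rewrite xy neq_ltn xy /= => /(_ isT c) Fxy.
  rewrite (hF' _ _ fxy) -?fval; have [_ <-] := fcode x; have [_ <-] := fcode y => //.
have [i xi] : exists j, x = e j.
  by apply/tagN; apply: contrapT => h; apply: nc; left.
have [j yj] : exists j, y = e j.
  by apply/tagN; apply: contrapT => h; apply: nc; right.
rewrite (core _ _ xi) (core _ _ yj); apply: ho'.1; apply: hg.1.
move: xy; rewrite xi yj; case: (ltngtP i j) => // [/ho.1|/val_inj ->].
  by case: ltngtP.
by rewrite ltnn.
Qed.

Lemma prod_le_trans (S T : Type) (leS : S -> S -> Prop) (leT : T -> T -> Prop) :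
  (forall x y z, leS x y -> leS y z -> leS x z) ->
  (forall x y z, leT x y -> leT y z -> leT x z) ->
  forall x y z, prod_le leS leT x y -> prod_le leS leT y z -> prod_le leS leT x z.
Proof.
by move=> trS trT x y z [xy1 xy2] [yz1 yz2]; split; [apply: trS xy1 yz1|apply: trT xy2 yz2].
Qed.

Lemma good_prod (S T : Type) (A : set S) (B : set T)
    (leS : S -> S -> Prop) (leT : T -> T -> Prop) :
  (forall x y z, leS x y -> leS y z -> leS x z) ->
  good A leS -> good B leT -> good (A `*` B) (prod_le leS leT).
Proof.
move=> trS gS gT f fAB.
have [g [gi gle]] := good_subsequence trS gS (f := fst \o f) (fun i => (fAB i).1).
have [i [j [ij l]]] := gT (snd \o f \o g) (fun i => (fAB _).2).
by exists (g i), (g j); split; [apply: gi|split=> //; apply: gle].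
Qed.

(** A labelled member of [J] is coded by its core, labelled by words that Higman's lemma makes a
    wqo, together with the finite table [F] and the word of the lowest strip, which has no core
    entry to carry it. *)
Lemma lwqo_framed (C J : set permutation) (K : nat) :
  lwqo C ->
  (forall p, J p -> exists s (e : 'I_(len s) -> 'I_(len p)) tag F,
     C s /\ @framing K _ _ p s e tag F) ->
  lwqo J.
Proof.
move=> lC hJ L le lePre /wqo_good leG.
have lexx : forall x, le x x by move=> x; reflexivity.
have letr : forall x y z, le x y -> le y z -> le x z.
  by move=> x y z xy yz; transitivity y.
apply: good_wqo; [exact: labelled_le_refl|exact: labelled_le_trans|].
pose Q : Type := (L * option 'I_K)%type.
pose leQ : Q -> Q -> Prop := prod_le le eq.
have leQQ x : leQ x x by split.
have leQtr x y z : leQ x y -> leQ y z -> leQ x z.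
  by apply: prod_le_trans => // a b c -> .
have leQG : good setT leQ.
  have := good_prod letr (leG lexx) (@good_finType (option 'I_K)).
  by rewrite setXTT.
have wG := higman leQtr leQG.
have wtr := subword_trans leQtr.
have wPre : RelationClasses.PreOrder (subword leQ).
  split; first by move=> u; apply: subword_refl.
  by move=> u v w; apply: wtr.
have cG := wqo_good (labelled_le_refl (subword_refl leQQ))
  (lC (seq Q) (subword leQ) wPre (good_wqo (subword_refl leQQ) wtr wG)).
have pG := good_prod (labelled_le_trans wtr) cG
  (good_prod wtr wG (@good_finType {ffun option 'I_K * option 'I_K * bool -> bool})).
move=> x xJ.
have code (i : nat) : exists c : labelled (seq Q) * (seq Q * {ffun option 'I_K * option 'I_K * bool -> bool}),
   exists (e : 'I_(len (underlying c.1)) -> 'I_(len (underlying (x i)))) tag,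
   let word := block_word (underlying (x i)) e (fun z => (label (x i) z, tag z)) in
   [/\ C (underlying c.1), framing (underlying (x i)) (underlying c.1) e tag c.2.2,
     c.2.1 = word 0 & forall j, label c.1 j = word (underlying c.1 j).+1].
  have [s [e [tag [F [Cs hF]]]]] := hJ _ (xJ i).
  exists (Labelled (fun j => block_word (underlying (x i)) e
    (fun z => (label (x i) z, tag z)) (s j).+1),
    (block_word (underlying (x i)) e (fun z => (label (x i) z, tag z)) 0, F)).
  by exists e, tag; split.
have [c hc] := choice code.
have [|i [j [ij [[g [hg gw]] [w0 EF]]]]] := pG c.
  by move=> i; split=> //; have [e [tag []]] := hc i.
exists i, j; split=> //.
have [e [tag [_ hF E0 Ew]]] := hc i; have [e' [tag' [_ hF' E0' Ew']]] := hc j.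
rewrite -EF in hF'; apply: (framing_embedding hF hF' hg).
  by move=> t; rewrite -Ew -Ew'.
by rewrite -E0 -E0'.
Qed.

(** * Monotone runs *)

Lemma strict_order_rank (T : finType) (r : rel T) :
  irreflexive r -> transitive r -> (forall x y, x != y -> r x y || r y x) ->
  exists2 g : T -> 'I_#|T|, bijective g & forall x y, r x y = (g x < g y).
Proof.
move=> rxx rtr rtot.
have lt x : #|[pred y | r y x]| < #|T|.
  have: [pred y | r y x] \proper T.
    by apply/properP; split; [apply/fintype.subsetP|exists x; rewrite // inE rxx].
  by move/proper_card.
pose g x := Ordinal (lt x).
have mono x y : r x y -> g x < g y.
  move=> xy; apply/proper_card/properP; split.
    by apply/fintype.subsetP => z; rewrite !inE => /rtr; apply.
  by exists x; rewrite ?inE ?xy // rxx.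
have gE x y : r x y = (g x < g y).
  apply/idP/idP => [/mono//|gxy].
  have [E|/rtot/orP[//|/mono]] := eqVneq x y; first by rewrite E ltnn in gxy.
  by move: gxy; case: ltngtP.
exists g => //; apply: inj_card_bij; last by rewrite card_ord.
move=> x y E; apply/eqP/negPn/negP => /rtot.
by rewrite !gE E ltnn.
Qed.

Lemma standardization (n : nat) (r : rel 'I_n) :
  irreflexive r -> transitive r -> (forall x y, x != y -> r x y || r y x) ->
  exists s : 'S_n, forall i j, (s i < s j) = r i j.
Proof.
move=> rxx rtr rtot; have [g gbij gE] := strict_order_rank rxx rtr rtot.
have inj : injective (fun i => cast_ord (card_ord n) (g i)).
  by move=> i j /cast_ord_inj/(bij_inj gbij).
by exists (perm inj) => i j; rewrite !permE /= gE.
Qed.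

Lemma subpattern (k n : nat) (p : 'S_n) (e : 'I_k -> 'I_n) :
  (forall i j : 'I_k, i < j -> e i < e j) -> exists s : 'S_k, occurrence s p e.
Proof.
move=> eI; have [|||s hs] := @standardization k (fun i j => p (e i) < p (e j)).
- by move=> i; rewrite ltnn.
- by move=> j i l; apply: ltn_trans.
- move=> i j; rewrite neq_ltn => ij; rewrite -neq_ltn.
  rewrite (inj_eq val_inj) (inj_eq perm_inj).
  by rewrite neq_ltn; case/orP: ij => /eI ->; rewrite ?orbT.
by exists s; split=> // i j; rewrite hs.
Qed.

Lemma finite_bounded_len (A : set permutation) :
  finite_set A <-> exists N, forall p, A p -> len p <= N.
Proof.
split=> [fA|[N hN]]; last first.
  pose T := {n : 'I_N.+1 & 'S_n}.
  apply: (@sub_finite_set _ A (range (fun x : T => Permutation (tagged x)))).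
    move=> p /hN; rewrite -ltnS; case: p => n p /= nN.
    by exists (existT (fun n : 'I_N.+1 => 'S_n) (Ordinal nN) p).
  by apply: finite_image; apply: finite_finset.
apply: contrapT => nb.
have [|g [gi hg]] := @increasing_in (fun l => exists2 p, A p & len p = l).
  move=> N; apply: contrapT => h; apply: nb; exists N => p Ap.
  rewrite leqNgt; apply/negP => Np; apply: h; exists (len p).
  by split; [apply: ltnW|exists p].
have ex i : exists p, A p /\ len p = g i by have [p Ap pl] := hg i; exists p.
have [f hf] := choice ex.
suff: infinite_set A by [].
apply/infinite_set_injP; exists f => [i j E|i]; last by have [] := hf i.
have lt := homo_ltn_succ gi.
have : g i = g j by have [_ <-] := hf i; have [_ <-] := hf j; rewrite E.
by case: (ltngtP i j) => // /lt + Eg; rewrite Eg ltnn.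
Qed.

(* The junk value 0 is returned beyond the length of the permutation. *)
Definition entry (n : nat) (p : 'S_n) (i : nat) : nat :=
  odflt 0 (omap (fun z : 'I_n => nat_of_ord (p z)) (insub i)).

Lemma entryE (n : nat) (p : 'S_n) (i : 'I_n) : entry p i = p i.
Proof. by rewrite /entry valK. Qed.

Lemma entry_neq (n : nat) (p : 'S_n) (i j : nat) :
  i < n -> j < n -> i != j -> entry p i != entry p j.
Proof.
move=> iN jN ij; rewrite (entryE p (Ordinal iN)) (entryE p (Ordinal jN)).
by rewrite (inj_eq val_inj) (inj_eq perm_inj).
Qed.

Section Runs.
Variables (n : nat) (p : 'S_n).

Let w : nat -> nat := entry p.
(** [run i] counts the changes of direction strictly before [i], so a turning entry belongs to the
    run that it ends. Directions alternate, hence [dir c] is the direction of run [c]. *)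
Let d (i : nat) : bool := w i < w i.+1.
Let turning (j : nat) : bool := (0 < j) && (d j.-1 != d j).
Let run (i : nat) : nat := count turning (iota 0 i).
Let dir (c : nat) : bool := d 0 (+) odd c.

Let wE : forall z : 'I_n, w z = p z := entryE p.
Let w_neq : forall i j, i < n -> j < n -> i != j -> w i != w j := @entry_neq n p.

Let runS i : run i.+1 = run i + turning i.
Proof. by rewrite /run -[in LHS]addn1 iotaD count_cat /= addn0. Qed.

Let run_le i j : i <= j -> run i <= run j.
Proof.
elim: j => [|j IH]; first by rewrite leqn0 => /eqP ->.
by rewrite leq_eqVlt => /predU1P[->//|/IH h]; rewrite runS (leq_trans h) ?leq_addr.
Qed.

Let dE j : d j = dir (run j.+1).
Proof.
elim: j => [|j IH]; first by rewrite /dir addbF.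
rewrite runS /dir oddD addbA -/(dir _) -IH /turning /=.
by case: (d j); case: (d j.+1).
Qed.

Let run_dir a b c : a < b -> b < n ->
  (forall j, a <= j < b -> run j.+1 = c) -> (w a < w b) = dir c.
Proof.
elim: b => // b IH; rewrite ltnS leq_eqVlt => /predU1P[<-|ab] bn h.
  by rewrite -(h a) ?leqnn // -dE.
have hb := h b; rewrite leqnn (ltnW ab) in hb.
have db := dE b; rewrite hb // /d in db.
have h' j : a <= j < b -> run j.+1 = c by move=> jab; apply: h; lia.
have {IH} := IH ab (ltnW bn) h'.
have nab := w_neq (ltn_trans ab (ltnW bn)) (ltnW bn) (negbT (ltn_eqF ab)).
have nb := w_neq (ltnW bn) bn (negbT (ltn_eqF (ltnSn b))).
have nab1 := w_neq (ltn_trans ab (ltnW bn)) bn (negbT (ltn_eqF (leqW ab))).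
case: (dir c) db; lia.
Qed.

(** The turning entries form the zigzag: between two consecutive ones the sequence is monotone, and
    its direction alternates. *)
Let run_zigzag : exists z : permutation,
  [/\ zigzag z, contained z (Permutation p) & forall i : 'I_n, run i <= len z].
Proof.
(* The bound [n.-1] keeps the junk value of [entry] out of the comparisons. *)
pose ts := [seq j <- iota 0 n.-1 | turning j].
have nth_run x : x \in ts -> nth 0 ts (run x) = x.
  rewrite mem_filter mem_iota add0n => /andP[tx /= xn].
  rewrite /ts -(subnKC xn) -[x.+1]addn1 -addnA iotaD add1n filter_cat nth_cat.
  by rewrite size_filter ltnn subnn /= add0n tx.
have uts : uniq ts by rewrite filter_uniq // iota_uniq.
pose m := size ts.
have run_nth i : i < m -> run (nth 0 ts i) = i.
  move=> im; apply/eqP.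
  have := nth_run _ (mem_nth 0 im) => E.
  have rm : run (nth 0 ts i) < m.
    have := mem_nth 0 im; set x := nth 0 ts i.
    rewrite mem_filter mem_iota add0n => /andP[tx /= xn].
    have := run_le xn; rewrite runS tx addn1 /m /ts size_filter.
    by move=> h; apply: leq_trans h _.
  by rewrite -(nth_uniq 0 rm im uts) E.
have tsn i : i < m -> nth 0 ts i < n.
  move=> /(mem_nth 0); rewrite mem_filter mem_iota => /andP[_]; rewrite add0n => /= h; lia.
have ts_lt i j : i < j -> j < m -> nth 0 ts i < nth 0 ts j.
  move=> ij jm; rewrite ltnNge; apply/negP => /run_le.
  by rewrite !run_nth ?(ltn_trans ij) // leqNgt ij.
pose e (i : 'I_m) := Ordinal (tsn i (ltn_ord i)).
have [|s hs] := @subpattern m n p e; first by move=> i j ij; apply: ts_lt.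
have step i : i.+1 < m -> (w (nth 0 ts i) < w (nth 0 ts i.+1)) = dir i.+1.
  move=> im; apply: run_dir; [exact: ts_lt|exact: (tsn)|] => j /andP[ij ji].
  have ti : turning (nth 0 ts i).
    by have := mem_nth 0 (ltnW im); rewrite mem_filter => /andP[].
  have := run_le ji; rewrite run_nth //.
  have := run_le ij; rewrite run_nth ?(ltnW im) //.
  have := run_le ij; rewrite -ltnS in ij; have := run_le ij.
  rewrite runS ti run_nth ?(ltnW im) //; lia.
exists (Permutation s); split.
- move=> [i [j [k [/= ji ki]]]].
  rewrite !hs.2 -!wE /=.
  have jm := ltn_ord j; have km := ltn_ord k.
  rewrite ji in jm *; rewrite ki in km *.
  have := step _ jm; have := step _ km; rewrite /dir /=.
  by case: (d 0 (+) odd i) => /=; lia.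
- by exists e.
- move=> i /=; rewrite /m size_filter; apply: run_le; have := ltn_ord i; lia.
Qed.

Lemma monotone_runs : exists (z : permutation) (r : 'I_n -> 'I_(len z).+1) (b : bool),
  [/\ zigzag z, contained z (Permutation p),
      forall i j : 'I_n, i <= j -> r i <= r j &
      forall i j : 'I_n, i < j -> r i = r j -> (p i < p j) = b (+) odd (r i)].
Proof.
have [z [zz zp zr]] := run_zigzag.
exists z, (fun i => inord (run i)), (d 0).
have rE (i : 'I_n) : @inord (len z) (run i) = run i :> nat by rewrite inordK ?ltnS ?zr.
split=> // i j ij.
  rewrite !rE; exact: run_le.
move=> /(congr1 val) /=; rewrite !rE => E.
rewrite -!wE; apply: run_dir => // t /andP[it tj].
by have := run_le it; have := run_le (leqnSn t); have := run_le tj; lia.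
Qed.
End Runs.

(** The entries of [t] are tagged by the number of their monotone run, of which there are at most
    [K] since the turns form a zigzag. *)
Lemma runs_framing (K n k : nat) (p : 'S_n) (s : 'S_k) (t : permutation)
    (e : 'I_k -> 'I_n) (f : 'I_(len t) -> 'I_n) (side : bool) :
  occurrence s p e -> occurrence t p f ->
  (forall i j, (e i < f j) = side) -> (forall i j, (f j < e i) = ~~ side) ->
  (forall x, (exists i, x = e i) \/ exists j, x = f j) ->
  (forall z, contained z t -> zigzag z -> len z < K) ->
  exists tag F, @framing K n k p s e tag F.
Proof.
move=> hs ht efE feE cover bound.
have [z [r [b [zz zt r_le rd]]]] := monotone_runs t.
have zK : len z < K by apply: bound => //; case: (t) zt.
have ex x : exists tx : option 'I_K, (tx = None /\ exists i, x = e i) \/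
    exists j, x = f j /\ tx = Some (widen_ord zK (r j)).
  have [[i ->]|[j ->]] := cover x.
    by exists None; left; split=> //; exists i.
  by exists (Some (widen_ord zK (r j))); right; exists j.
have [tag htag] := choice ex.
exists tag; exists [ffun u : option 'I_K * option 'I_K * bool =>
     match u.1.1, u.1.2 with
     | Some i, Some j => if i == j then u.2 == b (+) odd i else i < j
     | None, Some _ => side
     | _, _ => ~~ side end].
split=> // [x|x y].
  split; first by have [[_ //]|[j [_ ->]]] := htag x.
  move=> [i xi]; have [[-> //]|[j [xj _]]] := htag x.
  have := efE i j; have := feE i j; rewrite -xi -xj ltnn.
  by case: (side).
rewrite ffunE /=.
have [[tx [i xi]]|[i [xi tx]]] := htag x; have [[ty [j yj]]|[j [yj ty]]] := htag y;
  rewrite tx ty xi yj => xy; rewrite ?efE ?feE //; first by case.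
move=> _; rewrite -val_eqE /= -ht.2.
have lt i' j' : (f i' < f j') = (i' < j').
  case: (ltngtP i' j') => [/ht.1//| |/val_inj->]; last by rewrite ltnn.
  by move=> /ht.1; case: ltngtP.
have ij : i != j by apply: contraNneq xy => ->.
rewrite lt; case: eqVneq => [/val_inj E|ne].
  have := ij; rewrite neq_ltn => /orP[] /= lij.
    by rewrite lij (rd _ _ lij E) eqxx.
  have := rd _ _ lij (esym E); rewrite -E.
  have : t i != t j by rewrite (inj_eq perm_inj).
  rewrite -(inj_eq val_inj) /=; case: (b (+) _); rewrite /= ?eqb_id ?eqbF_neg; lia.
have := r_le i j; have := r_le j i; lia.
Qed.

(** The class with bounded zigzags is cut into runs, and the other one serves as core. *)
Lemma lwqo_juxtaposition (C D : set permutation) :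
  permutation_class C -> permutation_class D -> lwqo C -> lwqo D ->
  finite_set [set p | C p /\ zigzag p] \/ finite_set [set p | D p /\ zigzag p] ->
  lwqo (juxtaposition C D).
Proof.
move=> hC hD lC lD [] /finite_bounded_len[N hN].
- apply: (@lwqo_framed D _ N.+1 lD) => _ [k [m [q [s [t [-> Cs Dt hs ht]]]]]].
  exists (Permutation t), (@rshift k m).
  have [||||tag [F h]] := @runs_framing N.+1 _ _ q t (Permutation s) _ _ false ht hs.
  - by move=> i j /=; have := ltn_ord j; rewrite /=; lia.
  - by move=> i j /=; have := ltn_ord j; rewrite /=; lia.
  - by move=> x; case: (split_ordP x) => i ->; [right|left]; exists i.
  - by move=> z zs zz; rewrite ltnS; apply: hN; split=> //; apply: hC zs Cs.
  by exists tag, F.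
- apply: (@lwqo_framed C _ N.+1 lC) => _ [k [m [q [s [t [-> Cs Dt hs ht]]]]]].
  exists (Permutation s), (@lshift k m).
  have [||||tag [F h]] := @runs_framing N.+1 _ _ q s (Permutation t) _ _ true hs ht.
  - by move=> i j /=; have := ltn_ord i; rewrite /=; lia.
  - by move=> i j /=; have := ltn_ord i; rewrite /=; lia.
  - by move=> x; case: (split_ordP x) => i ->; [left|right]; exists i.
  - by move=> z zs zz; rewrite ltnS; apply: hN; split=> //; apply: hD zs Dt.
  by exists tag, F.
Qed.

(** * Ramsey's theorem *)

Lemma pigeonhole_count (T : Type) (K : finType) (f : T -> K) (N : nat) (s : seq T) :
  #|K| * N <= size s -> 0 < #|K| -> exists k, N <= count (fun x => f x == k) s.
Proof.
move=> sN K0; apply: contrapT => h.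
have lt k : count (fun x => f x == k) s < N.
  by rewrite ltnNge; apply/negP => hk; apply: h; exists k.
have sum : \sum_(k : K) count (fun x => f x == k) s = size s.
  elim: s {sN h lt} => [|x s IH] /=; first by rewrite big1.
  by rewrite big_split /= IH (bigD1 (f x)) //= eqxx big1 // => k /negbTE; rewrite eq_sym => ->.
have : \sum_(k : K) (count (fun x => f x == k) s).+1 <= \sum_(k : K) N.
  by apply: leq_sum.
have -> : \sum_(k : K) N = #|K| * N by rewrite sum_nat_const.
have one : \sum_(k : K) 1 = #|K| by rewrite sum1_card.
rewrite (eq_bigr (fun k => count (fun x => f x == k) s + 1)); last first.
  by move=> k _; rewrite addn1.
rewrite big_split /= sum one => /leq_trans/(_ sN).
by rewrite -[X in _ <= X]addn0 leq_add2l leqn0 (negbTE (lt0n_neq0 K0)).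
Qed.

Section Ramsey.
Variables (K : finType) (col : nat -> nat -> K).

(** The first element keeps the later ones joined to it by a most frequent colour, and the selection
    continues among them; the colour of a pair then depends on its earlier element only. *)
Lemma prehomogeneous_subseq (k0 : K) (m : nat) (s : seq nat) : #|K|.+1 ^ m <= size s ->
  exists t : seq (nat * K), [/\ size t = m, subseq (map fst t) s &
    pairwise (fun u v => col u.1 v.1 == u.2) t].
Proof.
elim: m s => [|m IH] [|x s] hs; try by exists [::]; split=> //; apply: sub0seq.
  have pos : 0 < #|K|.+1 ^ m.+1 by rewrite expn_gt0.
  by have := leq_trans pos hs.
have K0 : 0 < #|K| by apply/card_gt0P; exists k0.
have [k hk] : exists k, #|K|.+1 ^ m <= count (fun y => col x y == k) s.
  apply: pigeonhole_count => //.
  rewrite -ltnS; apply: leq_trans hs.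
  by rewrite expnS mulSn -[X in X < _]add0n ltn_add2r expn_gt0.
rewrite -size_filter in hk.
have [t [tm ts tp]] := IH _ hk.
exists ((x, k) :: t); split=> /=; first by rewrite tm.
  by rewrite eqxx; apply: subseq_trans ts (filter_subseq _ _).
rewrite tp andbT; apply/allP => u ut.
have : u.1 \in [seq y <- s | col x y == k] by apply: (mem_subseq ts); apply: map_f.
by rewrite mem_filter => /andP[].
Qed.

End Ramsey.

(** Among [#|K| * m] prehomogeneous elements, some [m] have the same recorded colour. *)
Lemma finite_ramsey (K : finType) (k0 : K) (m : nat) : exists N, forall col : nat -> nat -> K,
  exists (g : nat -> nat) (k : K), (forall i, i < m -> g i < N) /\
    forall i j, i < j -> j < m -> g i < g j /\ col (g i) (g j) = k.
Proof.
exists (#|K|.+1 ^ (#|K| * m)) => col.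
have [|t [tm ts tp]] := @prehomogeneous_subseq K col k0 (#|K| * m) (iota 0 (#|K|.+1 ^ (#|K| * m))).
  by rewrite size_iota.
have [||k hk] := @pigeonhole_count _ K snd m t; [by rewrite tm|by apply/card_gt0P; exists k0|].
pose u := [seq x <- t | x.2 == k]; pose g i := (nth (0, k0) u i).1.
rewrite -size_filter -/u in hk.
have gE i : i < m -> g i = nth 0 (map fst u) i.
  by move=> im; rewrite (nth_map (0, k0)) // (leq_trans im).
have us : subseq (map fst u) (iota 0 (#|K|.+1 ^ (#|K| * m))).
  by apply: subseq_trans ts; apply: map_subseq; apply: filter_subseq.
exists g, k; split=> [i im|i j ij jm].
  have : g i \in map fst u by rewrite gE // mem_nth // size_map (leq_trans im).
  by move/(mem_subseq us); rewrite mem_iota add0n => /andP[].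
have ju := leq_trans jm hk; have iu := ltn_trans ij ju.
split.
  have srt : sorted ltn (map fst u) := subseq_sorted ltn_trans us (iota_ltn_sorted _ _).
  rewrite !gE // ?(ltn_trans ij) //.
  by apply: (sorted_ltn_nth ltn_trans) => //; rewrite inE size_map.
have pu : pairwise (fun x y => col x.1 y.1 == x.2) u.
  by apply: subseq_pairwise tp; apply: filter_subseq.
have /pairwiseP -/(_ (0, k0) i j iu ju ij)/eqP -> := pu.
by have := mem_nth (0, k0) iu; rewrite mem_filter => /andP[/eqP].
Qed.

(** * Interleaving and cycles of chains *)

(** Closure under containment allows each side to be found inside a larger member [s] or [t] of its
    class. *)
Lemma juxtaposition_intro (C D : set permutation) (k m : nat) (q : 'S_(k + m))
    (s t : permutation)
    (e : 'I_k -> 'I_(len s)) (f : 'I_m -> 'I_(len t)) :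
  permutation_class C -> permutation_class D -> C s -> D t ->
  (forall i j : 'I_k, i < j -> e i < e j) -> (forall i j : 'I_m, i < j -> f i < f j) ->
  (forall i j, (q (lshift m i) < q (lshift m j)) = (s (e i) < s (e j))) ->
  (forall i j, (q (rshift k i) < q (rshift k j)) = (t (f i) < t (f j))) ->
  juxtaposition C D (Permutation q).
Proof.
move=> hC hD Cs Dt eI fI eV fV.
have [|s' hs'] := @subpattern k _ q (@lshift k m); first by [].
have [|t' ht'] := @subpattern m _ q (@rshift k m).
  by move=> i j ij; rewrite /= ltn_add2l.
exists k, m, q, s', t'; split=> //.
  by apply: (hC _ _ _ Cs); exists e; split=> // i j; rewrite hs'.2.
by apply: (hD _ _ _ Dt); exists f; split=> // i j; rewrite ht'.2.
Qed.

(** The other side is taken empty: the empty permutation is contained in [c] and in [d]. *)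
Lemma sub_juxtaposition (C D : set permutation) :
  permutation_class C -> permutation_class D -> C !=set0 -> D !=set0 ->
  C `<=` juxtaposition C D /\ D `<=` juxtaposition C D.
Proof.
move=> hC hD [c Cc] [d Dd].
have cast n k m (p : 'S_n) : n = k + m -> exists q : 'S_(k + m),
    Permutation p = Permutation q by move=> E; subst n; exists p.
split=> -[n p] h.
  have [q E] := cast n n 0 p (esym (addn0 n)).
  rewrite E in h *.
  by apply: (@juxtaposition_intro C D n 0 q (Permutation q) d (@lshift n 0)
    (fun i : 'I_0 => match notF (ltn_ord i) with end)) => //; case.
have [q E] := cast n 0 n p (esym (add0n n)).
rewrite E in h *.
by apply: (@juxtaposition_intro C D 0 n q c (Permutation q)
  (fun i : 'I_0 => match notF (ltn_ord i) with end) (@rshift 0 n)) => //; case.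
Qed.

Section Mix.
Local Open Scope Z_scope.

Lemma Z_ltb_total (a b : Z) : a <> b -> (a <? b) || (b <? a).
Proof. lia. Qed.

(* Positions are controlled only within one side, so the conclusion does not
   distinguish C and D. *)
Lemma juxtaposition_interleave (C D : set permutation) (T : finType) (side : pred T)
    (P V : T -> Z) (s t : permutation) (eC : T -> 'I_(len s)) (eD : T -> 'I_(len t)) :
  permutation_class C -> permutation_class D -> C s -> D t ->
  (forall x y, side x -> side y -> (P x <? P y) = (eC x < eC y)%N /\
     (V x <? V y) = (s (eC x) < s (eC y))%N) ->
  (forall x y, ~~ side x -> ~~ side y -> (P x <? P y) = (eD x < eD y)%N /\
     (V x <? V y) = (t (eD x) < t (eD y))%N) ->
  injective V ->
  exists2 p, juxtaposition C D p & exists e : T -> 'I_(len p),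
    (forall x y, (V x <? V y) = (p (e x) < p (e y))%N) /\
    forall x y, side x = side y -> (P x <? P y) = (e x < e y)%N.
Proof.
move=> hC hD Cs Dt hs ht Vinj.
(* Points of one side at equal positions are the same entry of [s] or [t], hence have equal
   values. *)
have Pinj x y : side x = side y -> P x = P y -> x = y.
  move=> xy Pxy; apply: Vinj.
  have [sx|sx] := boolP (side x).
    have sy : side y by rewrite -xy.
    have [p1 v1] := hs x y sx sy; have [p2 v2] := hs y x sy sx.
    have E : eC x = eC y by apply/val_inj => /=; lia.
    by rewrite E ltnn in v1 v2; lia.
  have sy : ~~ side y by rewrite -xy.
  have [p1 v1] := ht x y sx sy; have [p2 v2] := ht y x sy sx.
  have E : eD x = eD y by apply/val_inj => /=; lia.
  by rewrite E ltnn in v1 v2; lia.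
have rk (A : pred T) : (forall x y, A x -> A y -> side x = side y) ->
    exists2 g : {x | A x} -> 'I_#|{: {x | A x}}|, bijective g &
      forall x y, (P (val x) <? P (val y)) = (g x < g y)%N.
  move=> hA; apply: strict_order_rank => [x|y x z|x y]; [lia|lia|].
  move=> xy; have := Pinj _ _ (hA _ _ (valP x) (valP y)).
  move: xy; rewrite -(inj_eq val_inj) => /eqP xy h.
  by apply: Z_ltb_total => /h/xy.
have [|gL [gL' gLK gL'K] gLE] := rk side; first by move=> x y -> ->.
have [|gR [gR' gRK gR'K] gRE] := rk (fun x => ~~ side x).
  by move=> x y /negbTE -> /negbTE ->.
set k := #|{: {x | side x}}| in gL gL' gLK gL'K gLE *.
set m := #|{: {x | ~~ side x}}| in gR gR' gRK gR'K gRE *.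
(* [pt] lists the points of the left side by [P], then those of the right side by [P]; [q] will
   standardize their values under [V]. *)
pose pt (i : 'I_(k + m)) := match fintype.split i with inl a => val (gL' a) | inr b => val (gR' b) end.
have ptl a : pt (lshift m a) = val (gL' a) by rewrite /pt (unsplitK (inl a)).
have ptr b : pt (rshift k b) = val (gR' b) by rewrite /pt (unsplitK (inr b)).
have ptinj : injective pt.
  move=> i j; case: (split_ordP i) => a ->; case: (split_ordP j) => b ->; rewrite ?ptl ?ptr.
  - by move=> /val_inj/(can_inj gL'K) ->.
  - by move=> E; have := valP (gR' b); rewrite -E (valP (gL' a)).
  - by move=> E; have := valP (gR' a); rewrite E (valP (gL' b)).
  - by move=> /val_inj/(can_inj gR'K) ->.
have [|||q hq] := @standardization (k + m) (fun i j => V (pt i) <? V (pt j)).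
- by move=> i; lia.
- by move=> j i l; lia.
- move=> i j ij; apply: Z_ltb_total => /Vinj/ptinj E.
  by rewrite E eqxx in ij.
have ex x : exists i, pt i = x.
  have [sx|sx] := boolP (side x).
    by exists (lshift m (gL (exist _ x sx))); rewrite ptl gLK.
  by exists (rshift k (gR (exist _ x sx))); rewrite ptr gRK.
have [e he] := choice ex.
have sL a : side (val (gL' a)) by exact: valP.
have sR b : ~~ side (val (gR' b)) by exact: valP (gR' b).
have ltL a b : (P (val (gL' a)) <? P (val (gL' b))) = (a < b)%N by rewrite gLE !gL'K.
have ltR a b : (P (val (gR' a)) <? P (val (gR' b))) = (a < b)%N by rewrite gRE !gR'K.
exists (Permutation q).
  apply: (@juxtaposition_intro C D k m q s t (fun a => eC (val (gL' a))) (fun a => eD (val (gR' a)))) => //.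
  - by move=> a b; rewrite -(hs _ _ (sL a) (sL b)).1 ltL.
  - by move=> a b; rewrite -(ht _ _ (sR a) (sR b)).1 ltR.
  - by move=> a b; rewrite -(hs _ _ (sL a) (sL b)).2 hq !ptl.
  - by move=> a b; rewrite -(ht _ _ (sR a) (sR b)).2 hq !ptr.
exists e; split=> x y; first by rewrite hq !he.
rewrite -{1 2}(he x) -{1 2}(he y).
case: (split_ordP (e x)) => a Ea; case: (split_ordP (e y)) => b Eb; rewrite Ea Eb ?ptl ?ptr.
- by rewrite ltL.
- by rewrite sL (negbTE (sR b)).
- by rewrite sL (negbTE (sR a)).
- by rewrite ltR /= ltn_add2l.
Qed.
End Mix.

(** The comparison between consecutive chains of a cycle. Whether by value or by position,
    occurrences preserve and reflect it. *)
Definition step_rel (n : nat) (p : 'S_n) (R : bool * bool) (a b : 'I_n) : bool :=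
  let: (byval, flip) := R in
  let: (a', b') := if flip then (b, a) else (a, b) in
  if byval then p a' < p b' else a' < b'.

Lemma occurrence_lt (k n : nat) (s : 'S_k) (p : 'S_n) (e : 'I_k -> 'I_n) :
  occurrence s p e -> forall i j : 'I_k, (i < j) = (e i < e j).
Proof.
move=> [eI _] i j; case: (ltngtP i j) => [/eI->|/eI|/val_inj->] //.
  by case: ltngtP.
by rewrite ltnn.
Qed.

Lemma occurrence_step_rel (k n : nat) (s : 'S_k) (p : 'S_n) (e : 'I_k -> 'I_n) R :
  occurrence s p e -> forall i j, step_rel s R i j = step_rel p R (e i) (e j).
Proof.
by move=> h i j; case: R => -[] []; rewrite /step_rel /= ?h.2 -?(occurrence_lt h).
Qed.

Definition cycle_succ (k s : nat) : nat := if s.+1 == k then 0 else s.+1.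

(* Labels tell the chains apart and mark the ends of each chain. An embedding
   of the n-th permutation into the N-th then induces index maps phi_s with
   phi_0 (i + 1) <= phi_1 i + 1 <= ... <= phi_(k-1) i + 1 <= phi_0 i + 1,
   so phi_0 cannot send 0 to 0 and n to N > n. *)
Lemma not_lwqo_cycle (J : set permutation) (k : nat) (R : nat -> bool * bool) :
  1 < k ->
  (forall n, exists p (x : nat -> nat -> 'I_(len p)), [/\ J p,
    forall s s' i i', s < k -> s' < k -> i <= n -> i' <= n ->
      x s i = x s' i' -> s = s' /\ i = i' &
    forall s i j, s < k -> i <= n -> j <= n ->
      step_rel p (R s) (x s i) (x (cycle_succ k s) j) = (i <= j + (s == 0))]) ->
  ~ lwqo J.
Proof.
move=> k1 H lJ.
(* The extra chain number [k] labels the entries outside all chains. *)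
pose Lab : finType := ('I_k.+1 * bool * bool)%type.
have eqPre : RelationClasses.PreOrder (@eq Lab) by split; [|move=> ? ? ? -> ->].
have gJ := wqo_good (labelled_le_refl (@erefl Lab)) (lJ Lab eq eqPre
  (good_wqo (@erefl Lab) (@etrans Lab) (@good_finType Lab))).
have exl n : exists u : labelled Lab, J (underlying u) /\
   exists x : nat -> nat -> 'I_(len (underlying u)),
   [/\ forall s i, s < k -> i <= n -> label u (x s i) = (inord s, i == 0, i == n),
    forall a s b b', s < k -> label u a = (inord s, b, b') -> exists2 i, i <= n & a = x s i &
    forall s i j, s < k -> i <= n -> j <= n ->
      step_rel (underlying u) (R s) (x s i) (x (cycle_succ k s) j) = (i <= j + (s == 0))].
  have [p [x [Jp xinj xR]]] := H n.
  have ex (a : 'I_(len p)) : exists l : Lab,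
     (exists s i, [/\ s < k, i <= n, a = x s i & l = (inord s, i == 0, i == n)]) \/
     (l = (inord k, false, false) /\ forall s i, s < k -> i <= n -> a <> x s i).
    have [[s [i [sk si E]]]|h] := pselect (exists s i, [/\ s < k, i <= n & a = x s i]).
      by exists (inord s, i == 0, i == n); left; exists s, i.
    exists (inord k, false, false); right; split=> // s i sk si E; apply: h.
    by exists s, i.
  have [l hl] := choice ex.
  exists (Labelled l); split=> //; exists x; split=> //= [s i sk si|a s b b' sk].
    have [[s' [i' [sk' si' E ->]]]|[_ /(_ _ _ sk si)]] := hl (x s i); last by [].
    by have [-> ->] := xinj _ _ _ _ sk sk' si si' E.
  have [[s' [i' [sk' si' -> ->]]]|[-> _]] := hl a.
    move=> [/(congr1 val)]; rewrite /= !inordK; [|lia|lia].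
    by move=> -> _ _; exists i'.
  by move=> [/(congr1 val)]; rewrite /= !inordK; lia.
have [u hu] := choice exl.
have [|n [N [nN [f [fo fl]]]]] := gJ u; first by move=> n; have [] := hu n.
have [_ [x [xl _ xR]]] := hu n; have [_ [y [yl yx yR]]] := hu N.
(* Equal labels force [f (x s i)] onto the chain [y s], with first and last indices matched. *)
have ex (c : nat * nat) : exists j, c.1 < k -> c.2 <= n ->
    [/\ j <= N, f (x c.1 c.2) = y c.1 j, (c.2 == 0) = (j == 0) & (c.2 == n) = (j == N)].
  have [h|h] := boolP ((c.1 < k) && (c.2 <= n)); last first.
    by exists 0 => ck cn; case/negP: h; rewrite ck cn.
  have /andP[ck cn] := h.
  have l := fl (x c.1 c.2); rewrite xl // in l.
  have [j jN E] := yx _ _ _ _ ck (esym l).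
  exists j => _ _; move: l; rewrite E yl // => -[-> ->] //.
have [phi hphi] := choice ex.
have le s i j : s < k -> i <= n -> j <= n ->
    (i <= j + (s == 0)) = (phi (s, i) <= phi (cycle_succ k s, j) + (s == 0)).
  move=> sk si sj; have nk : cycle_succ k s < k by rewrite /cycle_succ; case: eqP; lia.
  have [/= iN Ei _ _] := hphi (s, i) sk si; have [/= jN Ej _ _] := hphi (cycle_succ k s, j) nk sj.
  by rewrite -xR // (occurrence_step_rel _ fo) Ei Ej yR.
have chain t i : i <= n -> t.+1 < k -> phi (1, i) <= phi (t.+1, i).
  move=> si; elim: t => // t IH tk; apply: leq_trans (IH (ltnW tk)) _.
  have := @le t.+1 i i (ltnW tk) si si; rewrite /cycle_succ (ltn_eqF tk) /= !addn0 leqnn.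
  by move=> <-.
have step i : i < n -> phi (0, i.+1) <= (phi (0, i)).+1.
  move=> si; have := @le 0 i.+1 i (ltnW k1) si (ltnW si).
  rewrite /cycle_succ (ltn_eqF k1) /= !addn1 leqnn => /esym h.
  apply: leq_trans h _; rewrite ltnS.
  (* The last chain is numbered [k - 1], and its comparison with chain 0 closes the cycle. *)
  case: k k1 le chain {H Lab eqPre gJ exl u hu f fo fl x xl xR y yl yx yR ex hphi} => // -[//|k'] _ le chain.
  apply: leq_trans (chain k' i (ltnW si) (ltnSn _)) _.
  have := @le k'.+1 i i (ltnSn _) (ltnW si) (ltnW si).
  by rewrite /cycle_succ eqxx /= !addn0 leqnn => <-.
have up i : i <= n -> phi (0, i) <= i.
  elim: i => [_|i IH si].
    by have [_ _ /esym/eqP-> _] := hphi (0, 0) (ltnW k1) (leq0n n).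
  by apply: leq_trans (step i si) _; rewrite ltnS IH // ltnW.
have [_ _ _ /=] := hphi (0, n) (ltnW k1) (leqnn n).
by rewrite eqxx => /esym/eqP E; have := up n (leqnn n); rewrite E leqNgt nN.
Qed.

(** * Regular patterns of pairs and the cycles built from them *)

Local Arguments Z.mul : simpl never.
Local Arguments Z.add : simpl never.
Local Arguments Z.opp : simpl never.
Local Arguments Z.sub : simpl never.
Local Arguments Z.of_nat : simpl never.

Definition sgZ (eps : bool) (z : Z) : Z := if eps then z else (- z)%Z.

Definition pair_pos (x : nat * bool) : Z := (2 * Z.of_nat x.1 + Z.b2z x.2)%Z.

(* Patterns x_0 y_0 ... x_N y_N, where (i, false) stands for x_i and (i, true)
   for y_i, and w gives the relative values of the entries. *)
Definition contains_pairs (C : set permutation) (w : nat * bool -> Z) (N : nat) : Prop :=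
  exists2 s, C s & exists e : nat * bool -> 'I_(len s), forall x y, x.1 <= N -> y.1 <= N ->
    (pair_pos x <? pair_pos y)%Z = (e x < e y) /\ (w x <? w y)%Z = (s (e x) < s (e y)).

(* The sum of copies of 21, or the skew sum of copies of 12. *)
Definition sum_word (eps : bool) (x : nat * bool) : Z :=
  sgZ eps (2 * Z.of_nat x.1 + Z.b2z (~~ x.2)).

(* Two monotone sequences, the x_i above all the y_i. *)
Definition vee_word (e1 e2 : bool) (N : nat) (x : nat * bool) : Z :=
  if x.2 then (sgZ e2 (Z.of_nat x.1) - Z.of_nat N - 1)%Z
  else (sgZ e1 (Z.of_nat x.1) + Z.of_nat N + 1)%Z.

(** Reduces a cycle to linear arithmetic. Member [i] of chain [s] is the pattern entry [r n s i],
    taken in [C] if [side s] and in [D] otherwise, and [V n s i] is its value after interleaving.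
    Values may be compared across the sides, positions only within one. *)
Lemma not_lwqo_interleaved (C D : set permutation) (swap : bool) (k : nat)
    (wC wD : nat -> nat * bool -> Z) (side : nat -> bool) (bound : nat -> nat)
    (r : nat -> nat -> nat -> nat * bool) (V : nat -> nat -> nat -> Z) (R : nat -> bool * bool) :
  permutation_class C -> permutation_class D -> 1 < k ->
  (forall N, contains_pairs C (wC N) N) -> (forall N, contains_pairs D (wD N) N) ->
  (forall n s i, s < k -> i <= n -> (r n s i).1 <= bound n) ->
  (forall n s i s' i', s < k -> s' < k -> i <= n -> i' <= n -> V n s i = V n s' i' -> s = s' /\ i = i') ->
  (forall n s i s' i', s < k -> s' < k -> i <= n -> i' <= n -> side s = side s' ->
    let w := (if side s then wC else wD) (bound n) in
    (V n s i <? V n s' i')%Z = (w (r n s i) <? w (r n s' i'))%Z) ->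
  (forall n s i j, s < k -> i <= n -> j <= n ->
    ((R s).1 || (side s == side (cycle_succ k s))) &&
    (let key t i := if (R s).1 then V n t i else pair_pos (r n t i) in
     let a := key s i in let b := key (cycle_succ k s) j in
     (if (R s).2 then b <? a else a <? b)%Z == (i <= j + (s == 0)))) ->
  ~ lwqo (if swap then juxtaposition D C else juxtaposition C D).
Proof.
move=> hC hD k1 cC cD rb Vinj Vw hR; apply: (not_lwqo_cycle (R := R) k1) => n.
pose T : finType := ('I_k * 'I_n.+1)%type.
pose P (x : T) := pair_pos (r n x.1 x.2); pose W (x : T) := V n x.1 x.2.
have [s Cs [eC hs]] := cC (bound n); have [t Dt [eD ht]] := cD (bound n).
have rbT (x : T) : (r n x.1 x.2).1 <= bound n by apply: rb; [apply: ltn_ord|apply: leq_ord].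
have Winj : injective W.
  move=> [a i] [b j] h.
  have [E1 E2] := Vinj n a i b j (ltn_ord a) (ltn_ord b) (leq_ord i) (leq_ord j) h.
  by congr pair; apply: val_inj.
have hs' (x y : T) : side x.1 -> side y.1 ->
    (P x <? P y)%Z = (eC (r n x.1 x.2) < eC (r n y.1 y.2)) /\
    (W x <? W y)%Z = (s (eC (r n x.1 x.2)) < s (eC (r n y.1 y.2))).
  move=> sx sy; have [h1 h2] := hs _ _ (rbT x) (rbT y); split=> //.
  by rewrite -h2 /W (Vw _ _ _ _ _ (ltn_ord _) (ltn_ord _) (leq_ord _) (leq_ord _)) sx // sy.
have ht' (x y : T) : ~~ side x.1 -> ~~ side y.1 ->
    (P x <? P y)%Z = (eD (r n x.1 x.2) < eD (r n y.1 y.2)) /\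
    (W x <? W y)%Z = (t (eD (r n x.1 x.2)) < t (eD (r n y.1 y.2))).
  move=> /negbTE sx /negbTE sy; have [h1 h2] := ht _ _ (rbT x) (rbT y); split=> //.
  by rewrite -h2 /W (Vw _ _ _ _ _ (ltn_ord _) (ltn_ord _) (leq_ord _) (leq_ord _)) sx // sy.
have [p Jp [e [eV eP]]] : exists2 p, (if swap then juxtaposition D C else juxtaposition C D) p &
    exists e : T -> 'I_(len p),
    (forall x y, (W x <? W y)%Z = (p (e x) < p (e y))) /\
    forall x y : T, side x.1 = side y.1 -> (P x <? P y)%Z = (e x < e y).
  case: swap.
    have [|p Jp [e [eV eP]]] := @juxtaposition_interleave D C T (fun x => ~~ side x.1) P W t s
      (fun x => eD (r n x.1 x.2)) (fun x => eC (r n x.1 x.2)) hD hC Dt Cs ht' _ Winj.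
      by move=> x y; rewrite !negbK; apply: hs'.
    by exists p => //; exists e; split=> // x y E; apply: eP; rewrite E.
  have [p Jp [e [eV eP]]] := @juxtaposition_interleave C D T (fun x => side x.1) P W s t
      (fun x => eC (r n x.1 x.2)) (fun x => eD (r n x.1 x.2)) hC hD Cs Dt hs' ht' Winj.
  by exists p => //; exists e.
pose pt (a i : nat) : T := (insubd (Ordinal (ltnW k1)) a, inord i).
have pt1 a i : a < k -> (pt a i).1 = a :> nat by move=> ak; rewrite val_insubd ak.
have pt2 a i : i <= n -> (pt a i).2 = i :> nat by move=> ?; rewrite inordK.
have einj : injective e.
  move=> x y E; apply: Winj; have := eV x y; have := eV y x; rewrite E ltnn; lia.
exists p, (fun a i => e (pt a i)); split=> // [a b i j ak bk iN jN|a i j ak iN jN].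
  move=> /einj E; split; [rewrite -(pt1 a i ak) -(pt1 b j bk)|rewrite -(pt2 a i iN) -(pt2 b j jN)];
  by rewrite E.
have nk : cycle_succ k a < k by rewrite /cycle_succ; case: eqP; lia.
have /andP[sd /eqP <-] := hR n a i j ak iN jN.
have VE : V n a i = W (pt a i) by rewrite /W pt1 // pt2.
have VE' : V n (cycle_succ k a) j = W (pt (cycle_succ k a) j) by rewrite /W pt1 // pt2.
have PE : pair_pos (r n a i) = P (pt a i) by rewrite /P pt1 // pt2.
have PE' : pair_pos (r n (cycle_succ k a) j) = P (pt (cycle_succ k a) j) by rewrite /P pt1 // pt2.
rewrite VE VE' PE PE'; case: (R a) sd => -[] [] /= sd; rewrite -?eV //.
  by rewrite eP // !pt1 // (eqP sd).
by rewrite eP // !pt1 // (eqP sd).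
Qed.

(** A pair of [C] encloses in value the upper entry of one pair of [D] and the lower entry of the
    next; this overlap provides the shift by one index in the cycle. *)
Lemma not_lwqo_sum_sum (C D : set permutation) (eps eps' : bool) :
  permutation_class C -> permutation_class D ->
  (forall N, contains_pairs C (sum_word eps) N) ->
  (forall N, contains_pairs D (sum_word eps') N) ->
  ~ lwqo (juxtaposition C D).
Proof.
move=> hC hD cC cD.
(* With val: lo lo' up lo+1 up' lo'+1 ..., where primes refer to D, the cycle
   is lo, up', lo', up. *)
pose E n (d : bool) i := if d then i else n - i.
refine (@not_lwqo_interleaved C D false 4 (fun _ => sum_word eps) (fun _ => sum_word eps')
  (fun s => (s == 0) || (s == 3)) id
  (fun n s i => match s with
    | 0 => (E n eps i, eps) | 1 => (E n eps' i, ~~ eps')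
    | 2 => (E n eps' i, eps') | _ => (E n eps i, ~~ eps) end)
  (fun n s i => Z.of_nat (4 * i + match s with 0 => 0 | 1 => 5 | 2 => 2 | _ => 3 end))
  (fun s => match s with 0 => (true, false) | 1 => (false, ~~ eps')
    | 2 => (true, false) | _ => (false, ~~ eps) end) hC hD isT cC cD _ _ _ _).
- by move=> n [|[|[|[|//]]]] i _ iN; rewrite /E; case: ifP => //=; lia.
- by move=> n [|[|[|[|//]]]] i [|[|[|[|//]]]] j _ _ iN jN; lia.
- by move=> n [|[|[|[|//]]]] i [|[|[|[|//]]]] j _ _ iN jN //= _;
    rewrite /sum_word /sgZ /E; case: (eps); case: (eps') => /=; lia.
- by move=> n [|[|[|[|//]]]] i j _ iN jN; apply/andP; split=> //; apply/eqP;
    rewrite /pair_pos /E /=; case: (eps); case: (eps') => /=; lia.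
Qed.

(** The offset exceeds every [h] used below, so all [low] values are negative and all [high] values
    positive. *)
Definition low (eps : bool) (n h : nat) : Z :=
  (sgZ eps (Z.of_nat h) - Z.of_nat (20 * n + 50))%Z.

Definition high (eps : bool) (n h : nat) : Z :=
  (sgZ eps (Z.of_nat h) + Z.of_nat (20 * n + 50))%Z.

(* The x_i and y_i of D are read in groups of four, C0 D0 D1 C2, where the C's
   lie above the D's. The pairs (a, b) of C below and (A, B) of C above enclose
   D1 of a group with D0 of the next one, and C0 with C2 of the same group:
     val^e2: D0 b D1 D0' a ...      val^e1: B C0 C2 A ...
   The cycle is D0, a, b, D1, C2, A, B, C0. *)
Lemma not_lwqo_sum_vee (C D : set permutation) (swap eps e1 e2 : bool) :
  permutation_class C -> permutation_class D ->
  (forall N, contains_pairs C (sum_word eps) N) ->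
  (forall N, contains_pairs D (vee_word e1 e2 N) N) ->
  ~ lwqo (if swap then juxtaposition D C else juxtaposition C D).
Proof.
move=> hC hD cC cD.
pose E n (d : bool) i := if d then i else n - i.
(* The upper or lower entry of the pair of [C] of rank [M], counted upwards in value among
   [2 * n + 2] pairs. The lower half interleaves with the y's of [D], the upper half with the
   x's. *)
pose pr n (M : nat) (isup : bool) := (E (2 * n + 1) eps M, isup (+) eps).
refine (@not_lwqo_interleaved C D swap 8 (fun _ => sum_word eps) (vee_word e1 e2)
  (fun s => match s with 1 | 2 | 5 | 6 => true | _ => false end) (fun n => 3 * n + 2)
  (fun n s i => match s with
    | 0 => (3 * i, true) | 3 => (3 * i + 1, true)
    | 4 => (3 * i + 2, false) | 7 => (3 * i, false)
    | 1 => pr n (E n e2 i) e2 | 2 => pr n (E n e2 i) (~~ e2)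
    | 5 => pr n (n.+1 + E n e1 i) e1 | _ => pr n (n.+1 + E n e1 i) (~~ e1) end)
  (fun n s i => match s with
    | 0 => low e2 n (4 * i)
    | 1 => low e2 n (4 * i + 5)
    | 2 => low e2 n (4 * i + 2)
    | 3 => low e2 n (4 * i + 3)
    | 4 => high e1 n (4 * i + 2)
    | 5 => high e1 n (4 * i + 3)
    | 6 => high e1 n (4 * i)
    | _ => high e1 n (4 * i + 1)
    end)
  (fun s => match s with 0 => (true, ~~ e2) | 1 => (false, e2 (+) eps)
    | 2 => (true, ~~ e2) | 3 => (false, false) | 4 => (true, ~~ e1)
    | 5 => (false, e1 (+) eps) | 6 => (true, ~~ e1) | _ => (false, false) end)
  hC hD isT cC cD _ _ _ _).
- by move=> n [|[|[|[|[|[|[|[|//]]]]]]]] i _ iN; rewrite /pr /E /=;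
    case: (eps); case: (e1); case: (e2) => /=; lia.
- by move=> n [|[|[|[|[|[|[|[|//]]]]]]]] i [|[|[|[|[|[|[|[|//]]]]]]]] j _ _ iN jN;
    rewrite /low /high /sgZ; case: (e1); case: (e2); lia.
- by move=> n [|[|[|[|[|[|[|[|//]]]]]]]] i [|[|[|[|[|[|[|[|//]]]]]]]] j _ _ iN jN //= _;
    rewrite /sum_word /vee_word /low /high /sgZ /pr /E; case: (eps); case: (e1); case: (e2) => /=; lia.
- by move=> n [|[|[|[|[|[|[|[|//]]]]]]]] i j _ iN jN; apply/andP; split=> //; apply/eqP;
    rewrite /pair_pos /pr /E /low /high /sgZ /=; case: (eps); case: (e1); case: (e2) => /=; lia.
Qed.

(* With x, y in C and x', y' in D, whose index is reversed if e1 <> e1', the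
   cycle is x, x', y', y. *)
Lemma not_lwqo_vee_vee_even (C D : set permutation) (e1 e2 e1' e2' : bool) :
  permutation_class C -> permutation_class D ->
  (forall N, contains_pairs C (vee_word e1 e2 N) N) ->
  (forall N, contains_pairs D (vee_word e1' e2' N) N) ->
  (e1 == e1') = (e2 == e2') ->
  ~ lwqo (juxtaposition C D).
Proof.
move=> hC hD cC cD e12.
refine (@not_lwqo_interleaved C D false 4 (vee_word e1 e2) (vee_word e1' e2')
  (fun s => match s with 0 | 3 => true | _ => false end) (fun n => n + 1)
  (fun n s i => match s with
    | 0 => (i + 1, false) | 3 => (i, true)
    | 1 => (if e1 == e1' then i else n + 1 - i, false)
    | _ => (if e1 == e1' then i else n - i, true) end)
  (fun n s i => match s with
    | 0 => high e1 n (2 * i)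
    | 1 => high e1 n (2 * i + 3)
    | 2 => low e2 n (2 * i)
    | _ => low e2 n (2 * i + 1)
    end)
  (fun s => match s with 0 => (true, ~~ e1) | 1 => (false, e1 != e1')
    | 2 => (true, ~~ e2) | _ => (false, false) end)
  hC hD isT cC cD _ _ _ _).
- by move=> n [|[|[|[|//]]]] i _ iN /=; case: (e1 == e1') => /=; lia.
- by move=> n [|[|[|[|//]]]] i [|[|[|[|//]]]] j _ _ iN jN;
    rewrite /low /high /sgZ; case: (e1); case: (e2); lia.
- by move=> n [|[|[|[|//]]]] i [|[|[|[|//]]]] j _ _ iN jN //= _;
    rewrite /vee_word /low /high /sgZ; case: (e1) e12; case: (e1'); case: (e2); case: (e2') => //= _; lia.
- by move=> n [|[|[|[|//]]]] i j _ iN jN; apply/andP; split=> //; apply/eqP;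
    rewrite /pair_pos /low /high /sgZ /=;
    case: (e1) e12; case: (e1'); case: (e2); case: (e2') => //= _; lia.
Qed.

(* The first and the second halves of the patterns give chains x1, y1, x2, y2
   in C and x1', y1', x2', y2' in D, those of the second half being indexed
   backwards; moreover D is read backwards if e2 <> e2'. The cycle is
   x1, x2', y2', y2, x2, x1', y1', y1. *)
Lemma not_lwqo_vee_vee_odd (C D : set permutation) (e1 e2 e1' e2' : bool) :
  permutation_class C -> permutation_class D ->
  (forall N, contains_pairs C (vee_word e1 e2 N) N) ->
  (forall N, contains_pairs D (vee_word e1' e2' N) N) ->
  (e1 == e1') = ~~ (e2 == e2') ->
  ~ lwqo (juxtaposition C D).
Proof.
move=> hC hD cC cD e12.
pose M n := 2 * n + 2.
(* The extra 1 makes reversal exact: x_(M+1-i) comes after y_(M-j) exactly when i <= j, just as x_i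
   comes before y_j. *)
pose X n i := (if e2 == e2' then i else M n + 1 - i, false).
pose Y n i := (if e2 == e2' then i else M n - i, true).
refine (@not_lwqo_interleaved C D false 8 (vee_word e1 e2) (vee_word e1' e2')
  (fun s => match s with 0 | 3 | 4 | 7 => true | _ => false end) (fun n => 2 * n + 3)
  (fun n s i => match s with
    | 0 => (i + 1, false) | 7 => (i, true) | 3 => (M n - i, true) | 4 => (M n - i, false)
    | 1 => X n (M n - i) | 2 => Y n (M n - i - 1) | 5 => X n i | _ => Y n i end)
  (fun n s i => match s with
    | 0 => high e1 n (2 * i)
    | 1 => high e1 n (2 * i + 3)
    | 4 => high e1 n (8 * n + 20 - 2 * i)
    | 5 => high e1 n (8 * n + 19 - 2 * i)
    | 2 => low e2 n (8 * n + 20 - 2 * i)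
    | 3 => low e2 n (8 * n + 19 - 2 * i)
    | 6 => low e2 n (2 * i)
    | _ => low e2 n (2 * i + 1)
    end)
  (fun s => match s with 0 => (true, ~~ e1) | 1 => (false, e2 == e2')
    | 2 => (true, e2) | 3 => (false, true) | 4 => (true, e1)
    | 5 => (false, e2 != e2') | 6 => (true, ~~ e2) | _ => (false, false) end)
  hC hD isT cC cD _ _ _ _).
- by move=> n [|[|[|[|[|[|[|[|//]]]]]]]] i _ iN; rewrite /X /Y /M /=; case: (e2 == e2') => /=; lia.
- by move=> n [|[|[|[|[|[|[|[|//]]]]]]]] i [|[|[|[|[|[|[|[|//]]]]]]]] j _ _ iN jN;
    rewrite /low /high /sgZ; case: (e1); case: (e2); lia.
- by move=> n [|[|[|[|[|[|[|[|//]]]]]]]] i [|[|[|[|[|[|[|[|//]]]]]]]] j _ _ iN jN //= _;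
    rewrite /vee_word /low /high /sgZ /X /Y /M;
    case: (e1) e12; case: (e1'); case: (e2); case: (e2') => //= _; lia.
- by move=> n [|[|[|[|[|[|[|[|//]]]]]]]] i j _ iN jN; apply/andP; split=> //; apply/eqP;
    rewrite /pair_pos /X /Y /M /low /high /sgZ /=;
    case: (e1) e12; case: (e1'); case: (e2); case: (e2') => //= _; lia.
Qed.

(** * Regular patterns in zigzags *)

(** The six shapes form a finite type, so that one of them can be found to occur for every [N]. *)
Definition pair_word (t : bool + bool * bool) (N : nat) : nat * bool -> Z :=
  match t with inl eps => sum_word eps | inr (e1, e2) => vee_word e1 e2 N end.

(** [vee_word] depends on [N], but the relative order of its initial entries does not. *)
Lemma contains_pairs_le (C : set permutation) t (N N' : nat) : N' <= N ->
  contains_pairs C (pair_word t N) N -> contains_pairs C (pair_word t N') N'.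
Proof.
move=> NN' [s Cs [e he]]; exists s => //; exists e => x y xN yN.
have [h1 h2] := he _ _ (leq_trans xN NN') (leq_trans yN NN'); split=> //.
rewrite -h2; case: t {h1 h2 he} => // -[e1 e2].
by case: x y xN yN => [i []] [j []] /= iN jN; rewrite /vee_word /sgZ /=; case: e1; case: e2; lia.
Qed.

Lemma zigzag_alternates (s : permutation) : zigzag s ->
  exists b : bool, forall i, i.+1 < len s -> (entry s i < entry s i.+1) = b (+) odd i.
Proof.
move=> zz; exists (entry s 0 < entry s 1).
have vne i : i.+1 < len s -> entry s i != entry s i.+1.
  by move=> il; apply: entry_neq; lia.
elim=> [|i IH] il; first by rewrite addbF.
rewrite /= addbN -(IH (ltnW il)).
have n1 := vne _ il; have n2 := vne _ (ltnW il).
have h : ~~ ((entry s i < entry s i.+1 < entry s i.+2) ||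
             (entry s i.+2 < entry s i.+1 < entry s i)).
  apply/negP => h; apply: zz.
  exists (Ordinal (ltnW (ltnW il))), (Ordinal (ltnW il)), (Ordinal il); split=> //.
  by rewrite -!entryE.
by move: h n1 n2; lia.
Qed.

(* By Ramsey's theorem the valleys a_i > b_i < c_i at every fourth position may
   be assumed to compare uniformly. Unless they form a decreasing sequence the
   pairs (a_i, b_i) are of one of the two shapes, and if they do then the pairs
   (b_i, c_i) are. *)
Lemma zigzag_contains_pairs (C : set permutation) :
  (forall N, exists s, [/\ C s, zigzag s & N <= len s]) ->
  forall N, exists t, contains_pairs C (pair_word t N) N.
Proof.
move=> hC N.
pose K : finType := (bool * bool * bool * bool * bool * bool)%type.
(* One index more than the pairs require, for the case where c_i is paired with b_(i+1). *)
have [Q hQ] := finite_ramsey ((false, false, false, false, false, false) : K) N.+2.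
have [s [Cs zz ls]] := hC (4 * Q + 4).
have [b hb] := zigzag_alternates zz.
pose v := entry s.
have l0 : 0 < len s by lia.
pose pos (i : nat) : 'I_(len s) := insubd (Ordinal l0) i.
have posE i : i < len s -> pos i = i :> nat by move=> il; rewrite val_insubd il.
have vE i : i < len s -> v i = s (pos i).
  by move=> il; rewrite -{1}(posE i il) /v entryE.
have neq i j : i < len s -> j < len s -> i != j -> v i != v j := @entry_neq _ s i j.
(* The offset [b] makes every [a i] the start of a descent. *)
pose a i := b + 4 * i.
have [g [k [gQ gk]]] := hQ (fun i j => (v (a i) < v (a j), v (a i).+1 < v (a j).+1,
   v (a i) < v (a j).+1, v (a i).+1 < v (a j), v (a i).+2 < v (a j).+2,
   v (a i).+1 < v (a j).+2)).
have al i : i < N.+2 -> (a (g i)).+2 < len s.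
  by move=> /gQ; rewrite /a; case: (b); lia.
have desc i : i < N.+2 -> v (a (g i)).+1 < v (a (g i)).
  move=> iN; have := hb (a (g i)) (ltnW (al i iN)).
  have -> : b (+) odd (a (g i)) = false.
    by rewrite /a oddD oddM addbF oddb addbb.
  have := @neq (a (g i)) (a (g i)).+1; have := al i iN; rewrite -!/(v _); lia.
have asc i : i < N.+2 -> v (a (g i)).+1 < v (a (g i)).+2.
  move=> iN; rewrite /v hb ?al //= /a oddD oddM addbF oddb.
  by rewrite addbN addbb.
case: k gk => [[[[[A B] X] Y] W] Z] gk.
have cmp i j : i < j -> j < N.+2 -> a (g i) + 4 <= a (g j) /\
  ((v (a (g i)) < v (a (g j))) = A /\ (v (a (g j)) < v (a (g i))) = ~~ A) /\
  ((v (a (g i)).+1 < v (a (g j)).+1) = B /\ (v (a (g j)).+1 < v (a (g i)).+1) = ~~ B) /\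
  ((v (a (g i)) < v (a (g j)).+1) = X /\ (v (a (g j)).+1 < v (a (g i))) = ~~ X) /\
  ((v (a (g i)).+1 < v (a (g j))) = Y /\ (v (a (g j)) < v (a (g i)).+1) = ~~ Y) /\
  ((v (a (g i)).+2 < v (a (g j)).+2) = W /\ (v (a (g j)).+2 < v (a (g i)).+2) = ~~ W) /\
  ((v (a (g i)).+1 < v (a (g j)).+2) = Z /\ (v (a (g j)).+2 < v (a (g i)).+1) = ~~ Z).
  move=> ij jN; have [gij [<- <- <- <- <- <-]] := gk i j ij jN.
  have ai := al i (ltn_trans ij jN); have aj := al j jN.
  have aij : a (g i) + 4 <= a (g j) by rewrite /a; lia.
  have opp x y : x < y -> y < len s -> (v x < v y) = (v x < v y) /\ (v y < v x) = ~~ (v x < v y).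
    move=> xy yl; split=> //; have := neq x y (ltn_trans xy yl) yl; lia.
  split=> //; do 5![split; first by apply: opp; lia].
  by apply: opp; lia.
have fin t (q : nat * bool -> nat) : (forall x, x.1 <= N -> q x < len s) ->
   (forall i j c d, i <= N -> j <= N ->
     (pair_pos (i, c) <? pair_pos (j, d))%Z = (q (i, c) < q (j, d)) /\
     (pair_word t N (i, c) <? pair_word t N (j, d))%Z = (v (q (i, c)) < v (q (j, d)))) ->
   exists t, contains_pairs C (pair_word t N) N.
  move=> ql qw; exists t; exists s => //; exists (fun x => pos (q x)) => -[i c] [j d] xN yN.
  by rewrite !posE ?ql // -!vE ?ql //; apply: qw.
have leN i : i <= N -> i < N.+2 by lia.
(* [X] puts each a_i below all later b_j, so the pairs (a_i, b_i) form a sum of 21's. *)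
have [x1|x0] := boolP X.
  apply: (fin (inl true) (fun x => a (g x.1) + x.2)) => [[i c] /= iN|i j c d iN jN].
    have := al _ (leN _ iN); case: c => /=; lia.
  have := desc i (leN i iN); have := desc j (leN j jN).
  rewrite /pair_word /sum_word /pair_pos /sgZ /= x1 in cmp *.
  case: (ltngtP i j) => [ij|ij|->].
  - have := cmp _ _ ij (leN j jN); case: c; case: d => /=; rewrite ?addn1 ?addn0; lia.
  - have := cmp _ _ ij (leN i iN); case: c; case: d => /=; rewrite ?addn1 ?addn0; lia.
  - case: c; case: d => /=; rewrite ?addn1 ?addn0; lia.
(* As [X] fails, [Y] puts every b below every a. *)
have [y1|y0] := boolP Y.
  apply: (fin (inr (A, B)) (fun x => a (g x.1) + x.2)) => [[i c] /= iN|i j c d iN jN].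
    have := al _ (leN _ iN); case: c => /=; lia.
  have := desc i (leN i iN); have := desc j (leN j jN).
  rewrite /pair_word /vee_word /pair_pos /sgZ /= (negbTE x0) y1 in cmp *.
  case: (ltngtP i j) => [ij|ij|->].
  - have := cmp _ _ ij (leN j jN); case: c; case: d => /=; rewrite ?addn1 ?addn0;
      case: (A) => /=; case: (B) => /=; lia.
  - have := cmp _ _ ij (leN i iN); case: c; case: d => /=; rewrite ?addn1 ?addn0;
      case: (A) => /=; case: (B) => /=; lia.
  - case: c; case: d => /=; rewrite ?addn1 ?addn0; case: (A); case: (B); lia.
(* As [Y] fails, the b's decrease, and [Z] then puts every b below every c. The pairs are (c_i,
   b_(i+1)), since in [vee_word] the upper entry comes first. *)
have [z1|z0] := boolP Z.
  apply: (fin (inr (W, false)) (fun x => if x.2 then (a (g x.1.+1)).+1 else (a (g x.1)).+2)).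
    by move=> [i []] /= iN; [have := al i.+1 iN|have := al i (leN i iN)]; lia.
  have dec i j : i < j -> j < N.+2 -> v (a (g j)).+1 < v (a (g i)).+1.
    move=> ij jN; have := cmp _ _ ij jN; have := desc j jN.
    by rewrite (negbTE y0) /=; lia.
  have above i j : i < N.+2 -> j < N.+2 -> v (a (g i)).+1 < v (a (g j)).+2.
    move=> iN jN; have := asc j jN; case: (ltngtP i j) => [ij|ij|->] //.
      by have := cmp _ _ ij jN; rewrite z1; lia.
    by have := dec _ _ ij iN; lia.
  have incr i j : i <= j -> j < N.+2 -> a (g i) <= a (g j).
    by rewrite leq_eqVlt => /predU1P[->//|ij] jN; have := cmp _ _ ij jN; lia.
  have lt4 i j : i < j -> j < N.+2 -> a (g i) + 4 <= a (g j) by move=> ij jN; have := cmp _ _ ij jN; lia.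
  have cc i j : i < j -> j < N.+2 -> (v (a (g i)).+2 < v (a (g j)).+2) = W /\
      (v (a (g j)).+2 < v (a (g i)).+2) = ~~ W.
    by move=> ij jN; have := cmp _ _ ij jN; lia.
  move=> i j c d iN jN; rewrite /pair_word /vee_word /pair_pos /sgZ /=.
  case: c; case: d => /=.
  - case: (ltngtP i j) => [ij|ij|->]; last lia.
      by have := lt4 i.+1 j.+1 ij jN; have := dec i.+1 j.+1 ij jN; lia.
    by have := lt4 j.+1 i.+1 ij iN; have := dec j.+1 i.+1 ij iN; lia.
  - have := above i.+1 j iN (leN j jN).
    case: (ltnP i j) => ij.
      by have := incr i.+1 j ij (leN j jN); case: (W) => /=; lia.
    by have := lt4 j i.+1 ij iN; case: (W) => /=; lia.
  - have := above j.+1 i jN (leN i iN).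
    case: (ltnP j i) => ij.
      by have := incr j.+1 i ij (leN i iN); case: (W) => /=; lia.
    by have := lt4 i j.+1 ij jN; case: (W) => /=; lia.
  - case: (ltngtP i j) => [ij|ij|->]; last lia.
      by have := lt4 i j ij (leN j jN); have := cc i j ij (leN j jN); case: (W) => /=; lia.
    by have := lt4 j i ij (leN i iN); have := cc j i ij (leN i iN); case: (W) => /=; lia.
(* Each b_i is now above all later b_j and c_j, so the pairs (b_i, c_i) form a skew sum of 12's. *)
apply: (fin (inl false) (fun x => (a (g x.1)).+1 + x.2)) => [[i c] /= iN|i j c d iN jN].
  have := al _ (leN _ iN); case: c => /=; lia.
have := asc i (leN i iN); have := asc j (leN j jN).
have := desc i (leN i iN); have := desc j (leN j jN).
rewrite /pair_word /sum_word /pair_pos /sgZ /= (negbTE y0) (negbTE z0) in cmp *.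
case: (ltngtP i j) => [ij|ij|->].
- have := cmp _ _ ij (leN j jN); case: c; case: d => /=; rewrite ?addn1 ?addn0; lia.
- have := cmp _ _ ij (leN i iN); case: c; case: d => /=; rewrite ?addn1 ?addn0; lia.
- case: c; case: d => /=; rewrite ?addn1 ?addn0; lia.
Qed.

(** If every shape [t] failed at some size [f t], none could occur at the size [\sum_t f t], which
    is at least each of them. *)
Lemma infinite_zigzags_pairs (C : set permutation) :
  ~ finite_set [set p | C p /\ zigzag p] ->
  exists t, forall N, contains_pairs C (pair_word t N) N.
Proof.
rewrite finite_bounded_len => unb.
have ex := @zigzag_contains_pairs C; apply: contrapT => h.
have ht t : exists N, ~ contains_pairs C (pair_word t N) N.
  by apply: contrapT => ht; apply: h; exists t => N; apply: contrapT => hN; apply: ht; exists N.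
have [f hf] := choice ht.
have [|t hC] := ex _ (\sum_t f t).
  move=> N; apply: contrapT => hN; apply: unb; exists N => p [Cp zp].
  by rewrite leqNgt; apply/negP => /ltnW Np; apply: hN; exists p.
by apply: (hf t); apply: contains_pairs_le hC; rewrite (bigD1 t) // leq_addr.
Qed.

Lemma not_lwqo_pairs (C D : set permutation) t t' :
  permutation_class C -> permutation_class D ->
  (forall N, contains_pairs C (pair_word t N) N) ->
  (forall N, contains_pairs D (pair_word t' N) N) ->
  ~ lwqo (juxtaposition C D).
Proof.
move=> hC hD; case: t => [eps|[e1 e2]]; case: t' => [eps'|[e1' e2']] /= cC cD.
- exact: not_lwqo_sum_sum cC cD.
- exact: (not_lwqo_sum_vee (swap := false) hC hD cC cD).
- exact: (not_lwqo_sum_vee (swap := true) hD hC cD cC).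
- have [E|E] := eqVneq (e1 == e1') (e2 == e2').
    exact: not_lwqo_vee_vee_even cC cD E.
  by apply: not_lwqo_vee_vee_odd cC cD _ => //; move: E; case: (e1 == e1'); case: (e2 == e2').
Qed.

Lemma lwqo_sub (A B : set permutation) : A `<=` B -> lwqo B -> lwqo A.
Proof.
move=> AB lB L le lePre leW; have [nochain noanti] := lB L le lePre leW.
split=> [[f hf]|[S [SA Sinf Santi]]].
  by apply: nochain; exists f => i; have [fA ? ?] := hf i; split=> //; apply: AB.
by apply: noanti; exists S; split=> // x /SA; apply: AB.
Qed.

(** Nonemptiness matters for the forward direction: with [C] empty the juxtaposition is empty and
    does not constrain [D]. *)
Theorem theorem1p1 (C D : set permutation)
    (hC : permutation_class C) (hD : permutation_class D)
    (C0 : C !=set0) (D0 : D !=set0) :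
  lwqo (juxtaposition C D) <->
  (lwqo C /\ lwqo D /\
   (finite_set [set p | C p /\ zigzag p] \/
    finite_set [set p | D p /\ zigzag p])).
Proof.
split=> [lJ|[lC [lD fin]]]; last exact: lwqo_juxtaposition.
have [CJ DJ] := sub_juxtaposition hC hD C0 D0.
split; [exact: lwqo_sub CJ lJ|split; [exact: lwqo_sub DJ lJ|]].
apply: contrapT => /not_orP[/infinite_zigzags_pairs[t ct] /infinite_zigzags_pairs[t' dt']].
exact: not_lwqo_pairs ct dt' lJ.
Qed.
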